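(* Let $m\ge 2$ and let $p_1,\ldots,p_m\in[1,\infty]$ be such that $\frac12\le\frac1{p_1}+\cdots+\frac1{p_m}<1$, with $1<p_i\le 2$ for a certain $i\in\{1,\ldots,m\}$. Put $$s_k=\begin{cases}\left[1-\left(\frac1{p_k}+\cdots+\frac1{p_m}\right)\right]^{-1}, & \text{if } k\le i,\\ 2, & \text{if } k>i.\end{cases}$$ Then there is a constant $C_m$, depending only on $m$, such that $$\left(\sum_{j_1=1}^n\left(\sum_{j_2=1}^n\cdots\left(\sum_{j_m=1}^n|A(e_{j_1},\ldots,e_{j_m})|^{s_m}\right)^{\frac{s_{m-1}}{s_m}}\cdots\right)^{\frac{s_1}{s_2}}\right)^{\frac1{s_1}}\le C_m\|A\|$$ for all positive integers $n$ and all $m$-linear forms $A\colon\ell_{p_1}^n\times\cdots\times\ell_{p_m}^n\to\mathbb K$. Moreover, the exponents $s_1,\ldots,s_i$ are optimal.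
   Context: $\mathbb K=\mathbb R$ or $\mathbb C$; $\ell_p^n$ is $\mathbb K^n$ with the $\ell_p$ norm; $e_j$ are the canonical unit vectors; $1/\infty=0$. For an $m$-linear form $A\colon\ell_{p_1}^n\times\cdots\times\ell_{p_m}^n\to\mathbb K$, $\|A\|:=\sup\{|A(z^{(1)},\ldots,z^{(m)})|:\ \|z^{(j)}\|_{\ell_{p_j}^n}\le 1,\ j=1,\ldots,m\}$. For fixed $p_1,\ldots,p_m$, call $(t_1,\ldots,t_m)\in(0,\infty)^m$ admissible if there is a constant $C$ (not depending on $n$ or $A$) such that $$\left(\sum_{j_1=1}^n\left(\cdots\left(\sum_{j_m=1}^n|A(e_{j_1},\ldots,e_{j_m})|^{t_m}\right)^{\frac{t_{m-1}}{t_m}}\cdots\right)^{\frac{t_1}{t_2}}\right)^{\frac1{t_1}}\le C\|A\|$$ for all positive integers $n$ and all $m$-linear forms $A\colon\ell_{p_1}^n\times\cdots\times\ell_{p_m}^n\to\mathbb K$. The exponent $s_k$ at position $k$ is optimal if every admissible $(t_1,\ldots,t_m)$ satisfies $t_k\ge s_k$. *)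

(* Defs.v *)
From HB Require Import structures.
From mathcomp Require Import all_boot all_order all_algebra.
From mathcomp Require Import complex.
From mathcomp Require Import all_classical all_reals all_analysis.

Set Implicit Arguments.
Unset Strict Implicit.
Unset Printing Implicit Defensive.

Import Order.TTheory GRing.Theory Num.Theory.

Local Open Scope ring_scope.

Variant scalar_field := RealField | ComplexField.

Definition scalars (R : realType) (F : scalar_field) : fieldType :=
  match F with RealField => R | ComplexField => R[i] end.

(* The modulus takes its values in R, whereas the norm that the library puts
   on R[i] takes its values in R[i]. *)
Definition modulus (R : realType) (F : scalar_field) : scalars R F -> R :=
  match F with
  | RealField => fun x : R => `|x|
  | ComplexField => fun z : R[i] => Normc.normc z
  end.

(* For p >= 1; the inverse of \bar R satisfies +oo^-1 = 0. *)
Definition recip (R : realType) (p : \bar R) : R := fine (p^-1)%E.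

(* The value at p = -oo is irrelevant: only p >= 1 is used. *)
Definition lp_norm (R : realType) (F : scalar_field) (n : nat) (p : \bar R)
    (x : 'rV[scalars R F]_n) : R :=
  match p with
  | r%:E => (\sum_(j < n) modulus (x 0 j) `^ r) `^ r^-1
  | +oo%E => \big[Num.max/0]_(j < n) modulus (x 0 j)
  | -oo%E => 0
  end.

Definition unit_vector (R : realType) (F : scalar_field) (n : nat) (j : 'I_n) :
  'rV[scalars R F]_n := delta_mx 0 j.

Definition multilinear (R : realType) (F : scalar_field) (m n : nat)
    (A : ('I_m -> 'rV[scalars R F]_n) -> scalars R F) : Prop :=
  forall (z : 'I_m -> 'rV[scalars R F]_n) (k : 'I_m),
    scalar (fun x : 'rV[scalars R F]_n => A (dfwith z k x)).

(* The supremum is taken in \bar R, so that it needs no boundedness side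
   condition; it is finite whenever A is multilinear and p k >= 1. *)
Definition form_norm (R : realType) (F : scalar_field) (m n : nat)
    (p : 'I_m -> \bar R) (A : ('I_m -> 'rV[scalars R F]_n) -> scalars R F) :
    \bar R :=
  ereal_sup [set (modulus (A z))%:E |
    z in [set z | forall k : 'I_m, lp_norm (p k) (z k) <= 1]]%classic.

(* nested_sum r t a is
     (\sum_(j1) ( ... (\sum_(jm) a (j1, ..., jm) ^ tm) ^ (t(m-1) / tm)
       ... ) ^ (t1 / t2)) ^ (r / t1),
   so that r is the exponent of the enclosing sum, and r = 1 at the outermost
   level. *)
Fixpoint nested_sum (R : realType) (n m : nat) (r : R) :
    ('I_m -> R) -> (m.-tuple 'I_n -> R) -> R :=
  match m with
  | 0%N => fun _ a => a [tuple] `^ r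
  | m'.+1 => fun t a =>
      (\sum_(j < n) nested_sum (t ord0) (fun k : 'I_m' => t (lift ord0 k))
                      (fun js => a [tuple of j :: js])) `^ (r / t ord0)
  end.

Definition coef_mixed_sum (R : realType) (F : scalar_field) (m n : nat)
    (t : 'I_m -> R) (A : ('I_m -> 'rV[scalars R F]_n) -> scalars R F) : R :=
  nested_sum 1 t (fun j : m.-tuple 'I_n =>
    modulus (A (fun k => unit_vector R F (tnth j k)))).

Definition hardy_littlewood (R : realType) (F : scalar_field) (m : nat)
    (p : 'I_m -> \bar R) (t : 'I_m -> R) (C : R) : Prop :=
  forall (n : nat) (A : ('I_m -> 'rV[scalars R F]_n) -> scalars R F),
    (0 < n)%N -> multilinear A ->
    ((coef_mixed_sum t A)%:E <= C%:E * form_norm p A)%E.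

Definition admissible (R : realType) (F : scalar_field) (m : nat)
    (p : 'I_m -> \bar R) (t : 'I_m -> R) : Prop :=
  (forall k : 'I_m, 0 < t k) /\ exists C : R, hardy_littlewood F p t C.

Definition optimal_at (R : realType) (F : scalar_field) (m : nat)
    (p : 'I_m -> \bar R) (s : 'I_m -> R) (k : 'I_m) : Prop :=
  forall t : 'I_m -> R, admissible F p t -> s k <= t k.

Definition hl_exponent (R : realType) (m : nat) (p : 'I_m -> \bar R)
    (i k : 'I_m) : R :=
  if (k <= i)%N then (1 - \sum_(l < m | (k <= l)%N) recip (p l))^-1 else 2.

(* Main.v *)
Require Import Defs.
From mathcomp Require Import all_boot all_order all_algebra.
From mathcomp Require Import complex ring lra.
From mathcomp Require Import all_classical all_reals all_analysis.

Set Implicit Arguments.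
Unset Strict Implicit.
Unset Printing Implicit Defensive.

Import Order.TTheory GRing.Theory Num.Theory.

Local Open Scope ring_scope.

(** The upper bound rests on two mechanisms.

    The first is weights. If [x] lies in the unit ball of [l_p], then inserting
    [x] in a variable turns a form on [l_p] into a form on [l_oo], on which signs
    can be averaged; and the supremum over [x] of the [l_u] norm of [x * b] is the
    [l_s] norm of [b], where [1 / s = 1 / u - 1 / p] ([lp_weights_dual]). This is
    how each reciprocal [1 / p_k] enters the exponents.

    The second is averaging over signs. Consider the variables from [i]
    on. As [1 / p_i >= 1 / 2], the sum [rho] of the other reciprocals is at most
    [1 / 2]. Khinchine's inequality, applied in all variables but one
    ([multiple_khinchine]), bounds for every choice of weights and every [l] the
    sum over [j_l] of the [l_2] norms of the weighted slices. Choosing the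
    weights from the slice norms themselves, and using weighted AM-GM, yields the
    unweighted estimate with exponent [1 / (1 - rho) <= 2] in place of [1]
    ([hardy_littlewood_slices]). A weight in the variable [i] raises this exponent
    to [s_i] ([mixed_sum_bound_first], where [i] comes first).

    A variable [k < i] is added in front of the mixed sum over the later
    variables, whose exponents are at least [2] and do not increase inwards. Such
    a mixed norm has cotype [s_(k+1)] with constant [1] ([nested_sum_cotype]):
    averaging over signs gives the outer exponent [s_(k+1)] for weighted unit
    vectors, and the supremum over the weights raises it to [s_k].
    This step of the induction ([mixed_sum_bound]) multiplies no constant.

    Optimality is witnessed by forms that read one fixed coordinate in the
    variables before [k] and are diagonal in the variables from [k] on
    ([diag_form]). Hoelder's inequality bounds the norm by
    [n ^ (1 - sum_(l >= k) 1 / p_l)], while the mixed sum is at least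
    [n ^ (1 / t_k)]; comparing the growth in [n] gives [t_k >= s_k]. *)

(** * Scalars and their modulus *)

Lemma le_eqW (R : realType) (x y : R) : x = y -> x <= y.
Proof. by move=> ->. Qed.

Section Scalars.
Variables (R : realType) (F : scalar_field).
Local Notation K := (scalars R F).
Local Notation mod := (@modulus R F).
Implicit Types (a b z : K) (c d : R).

Definition of_real : R -> K :=
  match F return R -> scalars R F with
  | RealField => fun c => c
  | ComplexField => fun c => (c%:C)%C
  end.

Lemma modulus_ge0 z : 0 <= mod z.
Proof.
rewrite /modulus; case: F z => [z|[x y]] /=; first exact: normr_ge0.
exact: sqrtr_ge0.
Qed.

Lemma modulus0 : mod 0 = 0.
Proof. by rewrite /modulus; case: F; [exact: normr0 | exact: Normc.normc0]. Qed.

Lemma modulus1 : mod 1 = 1.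
Proof. by rewrite /modulus; case: F; [exact: normr1 | exact: Normc.normc1]. Qed.

Lemma modulusM a b : mod (a * b) = mod a * mod b.
Proof.
rewrite /modulus; case: F a b => a b; [exact: normrM | exact: Normc.normcM].
Qed.

Lemma modulusN a : mod (- a) = mod a.
Proof.
rewrite /modulus; case: F a => [a|[x y]]; first exact: normrN.
by rewrite /= !sqrrN.
Qed.

Lemma sqr_modulus_real (a : R[i]) :
  @modulus R ComplexField a ^+ 2 = complex.Re a ^+ 2 + complex.Im a ^+ 2.
Proof. by case: a => x y /=; rewrite sqr_sqrtr // addr_ge0 // sqr_ge0. Qed.

Lemma modulusD a b : mod (a + b) <= mod a + mod b.
Proof.
rewrite /modulus; case: F a b => a b; first exact: ler_normD.
exact: le_normcD.
Qed.

Lemma modulus_sum (I : Type) (r : seq I) (f : I -> K) :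
  mod (\sum_(i <- r) f i) <= \sum_(i <- r) mod (f i).
Proof.
elim/big_rec2: _ => [|i x y _ H]; first by rewrite modulus0.
by apply: le_trans (modulusD _ _) _; rewrite lerD2l.
Qed.

Lemma modulus_prod (I : Type) (r : seq I) (f : I -> K) :
  mod (\prod_(i <- r) f i) = \prod_(i <- r) mod (f i).
Proof.
by elim/big_rec2: _ => [|i x y _ <-]; rewrite ?modulus1 ?modulusM.
Qed.

Lemma modulus_of_real c : mod (of_real c) = `|c|.
Proof.
rewrite /modulus /of_real; case: F => //=.
by rewrite expr0n /= addr0 sqrtr_sqr.
Qed.

Lemma of_real_sum (I : Type) (r : seq I) (f : I -> R) :
  of_real (\sum_(i <- r) f i) = \sum_(i <- r) of_real (f i).
Proof.
by rewrite /of_real; case: F => //=; rewrite raddf_sum.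
Qed.

(** The modulus is at most one instead of equal to one, so that the zero phase
    is allowed at [z = 0]. *)
Lemma unimodular_phase z : exists2 u, mod u <= 1 & u * z = of_real (mod z).
Proof.
rewrite /modulus /of_real; case: F z => [z|z].
  exists (Num.sg z); first by rewrite normr_sg; case: eqP.
  by rewrite normrEsg.
have [->|z0] := eqVneq z 0.
  by exists 0; rewrite ?mul0r Normc.normc0 //= ler01.
have n0 : Normc.normc z != 0 by apply: contra z0 => /eqP/Normc.eq0_normc ->.
exists ((Normc.normc z)%:C%C / z); last by rewrite divfK.
rewrite Normc.normcM Normc.normcV /= expr0n /= addr0 sqrtr_sqr ger0_norm ?divff //.
by case: (z) => x y; exact: sqrtr_ge0.
Qed.

Lemma modulus_parallelogram a b :
  mod (a + b) ^+ 2 + mod (a - b) ^+ 2 = 2 * mod a ^+ 2 + 2 * mod b ^+ 2.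
Proof.
case: F a b => a b.
  by rewrite /modulus !real_normK ?num_real //; ring.
rewrite !sqr_modulus_real; case: a b => [a1 a2] [b1 b2] /=; ring.
Qed.

(** The left-hand side is four times the absolute value of the real part of
    [a] times the conjugate of [b]. *)
Lemma modulus_cross a b :
  `|mod (a + b) ^+ 2 - mod (a - b) ^+ 2| <= 4 * (mod a * mod b).
Proof.
have ma := modulus_ge0 a; have mb := modulus_ge0 b.
have H x y : (x ^+ 2 <= (4 * (mod a * mod b)) ^+ 2) -> x = y ->
  `|y| <= 4 * (mod a * mod b).
  move=> H <-; rewrite -(ler_pXn2r (n := 2)) ?nnegrE ?normr_ge0 //.
    by rewrite real_normK ?num_real.
  by rewrite mulr_ge0 // mulr_ge0.
apply: (H _ _ _ erefl); rewrite !exprMn.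
case: F a b {H ma mb} => a b.
  by rewrite /modulus !real_normK ?num_real //; apply: le_eqW; ring.
rewrite !sqr_modulus_real; case: a b => [a1 a2] [b1 b2] /=.
rewrite -subr_ge0.
have -> : 4 ^+ 2 * ((a1 ^+ 2 + a2 ^+ 2) * (b1 ^+ 2 + b2 ^+ 2)) -
  ((a1 + b1) ^+ 2 + (a2 + b2) ^+ 2 - ((a1 - b1) ^+ 2 + (a2 - b2) ^+ 2)) ^+ 2
  = (4 * (a1 * b2 - a2 * b1)) ^+ 2 by ring.
exact: sqr_ge0.
Qed.

End Scalars.

(** * Real inequalities *)

Section RealInequalities.
Variable R : realType.
Implicit Types (x y q : R).

Lemma powR_le_mono x y q : 0 <= q -> 0 <= x -> x <= y -> x `^ q <= y `^ q.
Proof.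
move=> q0 x0 xy; apply: ge0_ler_powR => //; rewrite nnegrE //.
exact: le_trans xy.
Qed.

Lemma powR_superadditive x y q : 1 <= q -> 0 <= x -> 0 <= y ->
  x `^ q + y `^ q <= (x + y) `^ q.
Proof.
move=> q1 x0 y0; have q0 : 0 < q by exact: lt_le_trans q1.
have xy0 : 0 <= x + y by rewrite addr_ge0.
rewrite -(mulr_powRB1 x0) // -(mulr_powRB1 y0) // -(mulr_powRB1 xy0) // mulrDl.
by apply: lerD; apply: ler_wpM2l => //; apply: powR_le_mono;
  rewrite ?subr_ge0 ?lerDl ?lerDr.
Qed.

Lemma sum_powR_le (I : Type) (r : seq I) (P : pred I) (f : I -> R) q :
  1 <= q -> (forall i, 0 <= f i) ->
  \sum_(i <- r | P i) f i `^ q <= (\sum_(i <- r | P i) f i) `^ q.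
Proof.
move=> q1 f0; have q0 : 0 < q by exact: lt_le_trans q1.
suff [] : 0 <= \sum_(i <- r | P i) f i /\
  \sum_(i <- r | P i) f i `^ q <= (\sum_(i <- r | P i) f i) `^ q by [].
elim/big_rec2: _ => [|i y x _ [x0 IH]]; first by rewrite powR0 ?gt_eqF.
split; first by rewrite addr_ge0.
apply: le_trans (powR_superadditive q1 (f0 i) x0).
by rewrite lerD2l.
Qed.

Lemma powR_midpoint x y q : 1 <= q -> 0 <= x -> 0 <= y ->
  ((x + y) / 2) `^ q <= (x `^ q + y `^ q) / 2.
Proof.
move=> q1 x0 y0.
have h : (0 <= (2^-1 : R) <= 1)%R by lra.
have := convex_powR q1 (Itv01 (proj1 (andP h)) (proj2 (andP h))) (x := x) (y := y).
rewrite !inE /= !in_itv /= !andbT => /(_ x0 y0).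
rewrite convRE [X in X `^ _ <= _ -> _]convRE /= /unstable.onem.
have -> : 1 - 2^-1 = 2^-1 :> R by lra.
by rewrite -!mulrDr ![2^-1 * _]mulrC.
Qed.

Lemma cauchy_schwarz_sum (I : Type) (r : seq I) (P : pred I) (f g : I -> R) :
  (forall i, 0 <= f i) -> (forall i, 0 <= g i) ->
  \sum_(i <- r | P i) f i * g i <=
    Num.sqrt (\sum_(i <- r | P i) f i ^+ 2) *
    Num.sqrt (\sum_(i <- r | P i) g i ^+ 2).
Proof.
move=> f0 g0.
have H : 0 <= \sum_(i <- r | P i) f i * g i /\
   (\sum_(i <- r | P i) f i * g i) ^+ 2 <=
     (\sum_(i <- r | P i) f i ^+ 2) * (\sum_(i <- r | P i) g i ^+ 2) /\
   0 <= \sum_(i <- r | P i) f i ^+ 2 /\ 0 <= \sum_(i <- r | P i) g i ^+ 2.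
  elim/big_rec3: _ => [|i x y z _ [z0 [IH [y0 x0]]]].
    by rewrite expr0n mulr0 lexx.
  rewrite !addr_ge0 ?sqr_ge0 ?mulr_ge0 //; do 2!split => //.
  have a0 := f0 i; have b0 := g0 i; move: (f i) (g i) a0 b0 => a b a0 b0.
  suff : 2 * (a * b * z) <= a ^+ 2 * x + b ^+ 2 * y by nra.
  rewrite -(ler_pXn2r (n := 2)) ?nnegrE ?addr_ge0 ?mulr_ge0 ?sqr_ge0 //.
  have /(ler_wpM2l (mulr_ge0 (sqr_ge0 a) (sqr_ge0 b))) := IH.
  by have := sqr_ge0 (a ^+ 2 * x - b ^+ 2 * y); nra.
case: H => [s0 [H [f2 g2]]].
by rewrite -sqrtrM // -[leLHS]ger0_norm // -sqrtr_sqr ler_wsqrtr.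
Qed.

(** Tangent line of the exponential at the weighted mean of the exponents;
    the missing mass sits at the exponent zero. *)
Lemma expR_weighted_AMGM (I : finType) (th y : I -> R) :
  (forall i, 0 <= th i) -> \sum_i th i <= 1 ->
  expR (\sum_i th i * y i) <=
    \sum_i th i * expR (y i) + (1 - \sum_i th i).
Proof.
move=> th0 th1; set m := \sum_i th i * y i.
have tangent t : expR m * (1 + (t - m)) <= expR t.
  have -> : expR t = expR m * expR (t - m) by rewrite -expRD addrC subrK.
  by rewrite ler_wpM2l ?expR_ge0 // expR_ge1Dx.
have H1 : \sum_i th i * (expR m * (1 + (y i - m))) <= \sum_i th i * expR (y i).
  by apply: ler_sum => i _; rewrite ler_wpM2l.
have H2 := tangent 0; rewrite expR0 in H2.
have H3 : (1 - \sum_i th i) * (expR m * (1 + (0 - m))) <= 1 - \sum_i th i.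
  by rewrite -[leRHS]mulr1 ler_wpM2l // subr_ge0.
apply: le_trans (lerD H1 H3).
have -> : \sum_i th i * (expR m * (1 + (y i - m))) =
  expR m * ((1 - m) * (\sum_i th i) + m).
  rewrite (_ : _ + m = (1 - m) * \sum_i th i + \sum_i th i * y i) //.
  rewrite mulr_sumr -big_split /= mulr_sumr.
  by apply: eq_bigr => i _; ring.
by apply: le_eqW; ring.
Qed.

End RealInequalities.

(** * Unit balls and weights *)

Section Balls.
Variable R : realType.

(** Meant for nonnegative [x]; without the root and the modulus of [lp_norm],
    sums of powers can be compared directly. *)
Definition in_lp_ball (I : finType) (p : \bar R) (x : I -> R) : Prop :=
  match p with
  | r%:E => \sum_i x i `^ r <= 1
  | +oo%E => forall i, x i <= 1
  | -oo%E => False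
  end.

Lemma recipE (r : R) : 1 <= r -> recip r%:E = r^-1.
Proof.
move=> r1; rewrite /recip inver; case: eqP => [r0|//].
by move: r1; rewrite r0 ler10.
Qed.

Lemma recipy : recip (+oo : \bar R)%E = 0.
Proof. by rewrite /recip invey. Qed.

Lemma recip_ge0 (p : \bar R) : (1 <= p)%E -> 0 <= recip p.
Proof.
case: p => [r|_|//]; last by rewrite recipy.
by rewrite lee_fin => r1; rewrite recipE // invr_ge0 (le_trans _ r1).
Qed.

Lemma lp_norm_le1 (F : scalar_field) n (p : \bar R) (w : 'rV[scalars R F]_n) :
  (1 <= p)%E ->
  lp_norm p w <= 1 <-> in_lp_ball p (fun v => modulus (w 0 v)).
Proof.
case: p => [r|_|//] /=.
  rewrite lee_fin => r1; have r0 : 0 < r by exact: lt_le_trans r1.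
  have S0 : 0 <= \sum_(j < n) modulus (w 0 j) `^ r.
    by apply: sumr_ge0 => j _; exact: powR_ge0.
  split=> H.
    have := powR_le_mono (ltW r0) (powR_ge0 _ _) H.
    by rewrite powR1 -powRrM mulVf ?gt_eqF // powRr1.
  have := powR_le_mono (q := r^-1) _ S0 H.
  by rewrite invr_ge0 powR1; apply; exact: ltW.
split=> [H i|H].
  by apply: le_trans H; exact: (le_bigmax _ (fun j => modulus (w 0 j))).
exact: bigmax_le.
Qed.

Lemma in_lp_ball_le (I : finType) (p : \bar R) (x y : I -> R) : (1 <= p)%E ->
  (forall i, 0 <= x i <= y i) -> in_lp_ball p y -> in_lp_ball p x.
Proof.
case: p => [r|_|//] /=.
  rewrite lee_fin => r1 xy; apply: le_trans; apply: ler_sum => i _.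
  by have /andP[x0 xyi] := xy i; apply: powR_le_mono => //; exact: le_trans r1.
by move=> xy y1 i; have /andP[_ xyi] := xy i; exact: le_trans (y1 i).
Qed.

(** The weight that attains the supremum is the normalised power
    [b i `^ (s / p)]. *)
Lemma lp_weights_dual (I : finType) (p : \bar R) (u s c : R) (b : I -> R) :
  (1 <= p)%E -> 0 < u -> 0 < s -> s^-1 = u^-1 - recip p ->
  (forall i, 0 <= b i) -> 0 <= c ->
  (forall x : I -> R, (forall i, 0 <= x i) -> in_lp_ball p x ->
     \sum_i (x i * b i) `^ u <= c `^ u) ->
  \sum_i b i `^ s <= c `^ s.
Proof.
case: p => [r|_|//]; last first.
  rewrite recipy subr0 => u0 s0 /invr_inj -> b0 c0 /(_ (fun=> 1)).
  have -> : \sum_i (1 * b i) `^ u = \sum_i b i `^ u.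
    by apply: eq_bigr => i _; rewrite mul1r.
  by apply=> /=.
rewrite lee_fin => r1 u0 s0; rewrite recipE // => su b0 c0 H.
have r0 : 0 < r by exact: lt_le_trans r1.
set M := \sum_i b i `^ s.
have M0 : 0 <= M by apply: sumr_ge0 => i _; exact: powR_ge0.
have [->|Mn0] := eqVneq M 0; first exact: powR_ge0.
(* The power of [b i] contributed by the weight and by [b i] itself. *)
have e : s * u * r^-1 + u = s.
  have -> : r^-1 = u^-1 - s^-1 by rewrite su; ring.
  by field; rewrite !gt_eqF.
have := H (fun i => (b i `^ s / M) `^ r^-1).
have -> : \sum_i ((b i `^ s / M) `^ r^-1 * b i) `^ u = M / M `^ (u * r^-1).
  rewrite /M mulr_suml; apply: eq_bigr => i _; rewrite -/M.
  have -> : ((b i `^ s / M) `^ r^-1 * b i) `^ u =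
      (b i `^ (s * (r^-1 * u)) * b i `^ u) * M^-1 `^ (r^-1 * u).
    rewrite powRM ?powR_ge0 // -[(_ `^ r^-1) `^ _]powRrM powRM ?powR_ge0 ?invr_ge0 //.
    by rewrite -[(b i `^ s) `^ _]powRrM mulrAC.
  have e' : s * (r^-1 * u) + u = s by rewrite -{2}e; ring.
  rewrite -powRD ?e' ?(gt_eqF s0) //; congr (_ * _).
  by rewrite -[M^-1]powR_inv1 // -powRrM mulN1r powRN mulrC.
move=> /(_ (fun i => powR_ge0 _ _)) /=.
have -> : \sum_i ((b i `^ s / M) `^ r^-1) `^ r = 1.
  under eq_bigr => i _ do rewrite -powRrM mulVf ?gt_eqF // powRr1 ?divr_ge0 ?powR_ge0 //.
  by rewrite -mulr_suml -/M divff.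
move=> /(_ (lexx _)) Hc.
have E1 : M / M `^ (u * r^-1) = M `^ (u / s).
  rewrite -{1}[M]powRr1 // -powRB ?Mn0 ?implybT //; congr (_ `^ _).
  by rewrite -{1}(divff (lt0r_neq0 s0)) -{1}e; field; rewrite !gt_eqF.
rewrite E1 in Hc.
have su0 : 0 <= s / u by rewrite divr_ge0 // ltW.
have := powR_le_mono su0 (powR_ge0 _ _) Hc; rewrite -!powRrM.
have -> : u / s * (s / u) = 1 by field; rewrite !gt_eqF.
have -> : u * (s / u) = s by field; rewrite !gt_eqF.
by rewrite powRr1.
Qed.

End Balls.

(** * From weighted to unweighted slices *)

(** Here [J] indexes the coefficients [a] of a form, [pr l j] is the index of
    [j] in the variable [l], and [slice_norm a l v] is the [l_2] norm of the
    coefficients whose index in the variable [l] is [v]. *)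
Section HardyLittlewood.
Variables (R : realType) (I V J : finType) (pr : I -> J -> V).
Variables (p : I -> \bar R) (a : J -> R) (c : R).
Hypothesis p1 : forall l, (1 <= p l)%E.
Hypothesis a0 : forall j, 0 <= a j.

Let rho := \sum_l recip (p l).
Let lam := (1 - rho)^-1.

Definition slice_norm (b : J -> R) l v :=
  Num.sqrt (\sum_(j | pr l j == v) b j ^+ 2).

Hypothesis rho_half : rho <= 2^-1.
Hypothesis weighted : forall x : I -> V -> R, (forall l v, 0 <= x l v) ->
  (forall l, in_lp_ball (p l) (x l)) -> forall l,
  \sum_v slice_norm (fun j => a j * \prod_k x k (pr k j)) l v <= c.

Let S := slice_norm a.
Let M l := \sum_v S l v `^ lam.

Let lam_gt0 : 0 < lam.
Proof. by rewrite invr_gt0; move: rho_half; lra. Qed.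

Let lam_le2 : lam <= 2.
Proof.
have h : (2 : R)^-1 <= 1 - rho by move: rho_half; lra.
rewrite /lam -[leRHS]invrK lef_pV2 ?posrE //; first exact: lt_le_trans h.
Qed.

Let S_ge0 l v : 0 <= S l v. Proof. exact: sqrtr_ge0. Qed.

Let sqrS l v : S l v ^+ 2 = \sum_(j | pr l j == v) a j ^+ 2.
Proof. by rewrite sqr_sqrtr // sumr_ge0 // => j _; exact: sqr_ge0. Qed.

Let S_gt0 l j : a j != 0 -> 0 < S l (pr l j).
Proof.
move=> aj; rewrite lt_neqAle S_ge0 andbT eq_sym -sqrf_eq0 sqrS gt_eqF //.
rewrite (bigD1 j) //= ltr_pwDl ?exprn_gt0 ?lt0r ?aj ?a0 //.
by apply: sumr_ge0 => k _; exact: sqr_ge0.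
Qed.

Let M_eq l : M l = \sum_j a j ^+ 2 * S l (pr l j) `^ (lam - 2).
Proof.
rewrite (partition_big (pr l) predT) //=; apply: eq_bigr => v _.
rewrite (eq_bigr (fun j => a j ^+ 2 * S l v `^ (lam - 2))); last first.
  by move=> j /eqP ->.
rewrite -mulr_suml -sqrS -powR_mulrn //.
have [S0|Sn0] := eqVneq (S l v) 0.
  by rewrite S0 (powR0 (lt0r_neq0 lam_gt0)) (@powR0 _ 2%:R) ?mul0r ?pnatr_eq0.
by rewrite -powRD ?Sn0 ?implybT // [2%:R + _]addrC subrK.
Qed.

(** Let [M] be the largest over [k] of the sums of the [S k v `^ lam], attained at
    [k = i]. The weights
    [(S k v `^ lam / M) `^ (1 / p k)] lie in the unit balls. By Cauchy-Schwarz
    on each slice, the weighted hypothesis bounds the sum over [j] of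
    [a j ^+ 2 * X j / S k (pr k j)] for every [k], with [X] the product of the
    weights. The convex combination of these sums with coefficients
    [th k = lam / p k + (2 - lam) * (k == i)] dominates, by AM-GM, the sum of
    [a j ^+ 2 * S i (pr i j) `^ (lam - 2)] divided by [M `^ rho], that is,
    [M `^ (1 - rho) = M `^ lam^-1]. *)
Lemma hardy_littlewood_slices l : M l <= c `^ lam.
Proof.
pose i := [arg max_(i > l) M i]%O.
have Mi k : M k <= M i by rewrite /i; case: arg_maxP => // i' _; exact.
apply: le_trans (Mi l) _; set m := M i.
have m_ge0 : 0 <= m by apply: sumr_ge0 => v _; exact: powR_ge0.
have [->|m_neq0] := eqVneq m 0; first exact: powR_ge0.
have m_gt0 : 0 < m by rewrite lt_neqAle eq_sym m_neq0.
pose x k v := (S k v `^ lam / m) `^ recip (p k).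
have x_ge0 k v : 0 <= x k v by exact: powR_ge0.
have x_ball k : in_lp_ball (p k) (x k).
  have := p1 k; rewrite /x; case: (p k) => [r|_|//] /=; last first.
    by move=> v; rewrite recipy powRr0.
  rewrite lee_fin => r1; have r0 : 0 < r by exact: lt_le_trans r1.
  under eq_bigr => v _ do rewrite -powRrM recipE // mulVf ?gt_eqF //
    powRr1 ?divr_ge0 ?powR_ge0 //.
  by rewrite -mulr_suml ler_pdivrMr // mul1r; exact: Mi.
pose X j := \prod_k x k (pr k j).
have X_ge0 j : 0 <= X j by apply: prodr_ge0 => k _.
(* On a slice, the norms of [a] and [a * X] bound the sum of [a ^+ 2 * X];
   dividing by [S k v] leaves the weighted slice norm. *)
have Q_le k : \sum_j a j ^+ 2 * X j / S k (pr k j) <= c.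
  apply: le_trans (weighted x_ge0 x_ball k).
  rewrite (partition_big (pr k) predT) //=; apply: ler_sum => v _.
  rewrite (eq_bigr (fun j => a j * (a j * X j) / S k v)); last first.
    by move=> j /eqP ->; rewrite mulrA -expr2.
  rewrite -mulr_suml.
  have [->|Sn0] := eqVneq (S k v) 0; first by rewrite invr0 mulr0 sqrtr_ge0.
  rewrite ler_pdivrMr ?lt_neqAle ?S_ge0 1?eq_sym ?Sn0 //.
  rewrite [leRHS]mulrC.
  apply: le_trans (cauchy_schwarz_sum _ _ _ _) _ => //.
  by move=> j; rewrite mulr_ge0.
(* The coefficients for which the powers of all the [S k] with [k != i]
   cancel; they are nonnegative because [lam <= 2]. *)
pose th k := lam * recip (p k) + (2 - lam) * (k == i)%:R.
have th_ge0 k : 0 <= th k.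
  by rewrite addr_ge0 // mulr_ge0 ?recip_ge0 ?subr_ge0 // ltW.
have lam_rho : lam * rho = lam - 1.
  have h : 1 - rho != 0 by rewrite lt0r_neq0 // -invr_gt0.
  by rewrite /lam; field.
have sum_delta (f : I -> R) : \sum_k (k == i)%:R * f k = f i.
  rewrite (bigD1 i) //= eqxx mul1r big1 ?addr0 // => k /negbTE ->.
  by rewrite mul0r.
have th_sum : \sum_k th k = 1.
  rewrite /th big_split /= -mulr_sumr -/rho lam_rho -mulr_sumr.
  under [X in _ + _ * X]eq_bigr => k _ do rewrite -[_%:R]mulr1.
  by rewrite sum_delta; ring.
(* In exponential form, [X j / S k (pr k j)] is [expR (y k)], and the mean of
   the [y k] with weights [th] is [(lam - 2) * sg i - rho * ln m]. *)
have pointwise j : a j ^+ 2 * S i (pr i j) `^ (lam - 2) * expR (- rho * ln m) <=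
    \sum_k th k * (a j ^+ 2 * X j / S k (pr k j)).
  have [->|aj] := eqVneq (a j) 0.
    rewrite expr0n !mul0r sumr_ge0 // => k _.
    by rewrite mul0r mulr0.
  pose sg k := ln (S k (pr k j)).
  have S_exp k : S k (pr k j) = expR (sg k) by rewrite lnK // posrE S_gt0.
  have X_exp : X j = expR (lam * \sum_k recip (p k) * sg k - rho * ln m).
    rewrite mulr_sumr mulr_suml -sumrB expR_sum; apply: eq_bigr => k _.
    rewrite /x /powR gt_eqF ?divr_gt0 ?powR_gt0 ?S_gt0 //.
    rewrite ln_div ?posrE ?powR_gt0 ?S_gt0 // ln_powR.
    by congr expR; rewrite /sg; ring.
  set L := \sum_k recip (p k) * sg k in X_exp.
  pose y k := lam * L - rho * ln m - sg k.
  have := expR_weighted_AMGM y th_ge0; rewrite th_sum => /(_ (lexx _)).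
  rewrite subrr addr0.
  have -> : \sum_k th k * y k = (lam - 2) * sg i - rho * ln m.
    have -> : \sum_k th k * y k = (lam * L - rho * ln m) * \sum_k th k
        - (lam * L + (2 - lam) * \sum_k (k == i)%:R * sg k).
      rewrite [X in _ - (X + _)]mulr_sumr [X in _ - (_ + X)]mulr_sumr mulr_sumr.
      rewrite -big_split /= -sumrB.
      by apply: eq_bigr => k _; rewrite /y /th; ring.
    by rewrite sum_delta th_sum; ring.
  move=> H; rewrite -mulrA S_exp /powR gt_eqF ?expR_gt0 // expRK -expRD mulNr.
  apply: le_trans (ler_wpM2l (sqr_ge0 _) H) _.
  rewrite mulr_sumr; apply: ler_sum => k _.
  by rewrite S_exp X_exp -[_ / _]mulrA -expRN -expRD mulrCA.
have key : m * expR (- rho * ln m) <= c.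
  rewrite {1}/m M_eq mulr_suml.
  apply: le_trans (ler_sum _ (fun j _ => pointwise j)) _.
  rewrite exchange_big /=.
  apply: (@le_trans _ _ (\sum_k th k * c)); last by rewrite -mulr_suml th_sum mul1r.
  by apply: ler_sum => k _; rewrite -mulr_sumr ler_wpM2l.
have e : m * expR (- rho * ln m) = expR (lam^-1 * ln m).
  rewrite -{1}[m]lnK ?posrE // -expRD; congr expR.
  by rewrite /lam invrK; ring.
rewrite e in key.
have := powR_le_mono (ltW lam_gt0) (expR_ge0 _) key.
rewrite {1}/powR gt_eqF ?expR_gt0 // expRK mulrA divff ?gt_eqF // mul1r.
by rewrite lnK ?posrE.
Qed.

End HardyLittlewood.

(** * Averages over signs *)

Section Rademacher.
Variables (R : realType) (V : zmodType) (I : Type) (b : I -> V).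
Implicit Types (f g : V -> R) (r : seq I) (w : V).

(** The expectation of [f (w + \sum_i e_i * b i)] over independent signs [e_i];
    the recursion reveals one sign at a time. *)
Fixpoint radavg r f w : R :=
  if r is i :: r' then (radavg r' f (w + b i) + radavg r' f (w - b i)) / 2
  else f w.

Lemma radavg_mono r f g w : (forall w, f w <= g w) -> radavg r f w <= radavg r g w.
Proof.
move=> fg; elim: r w => [|i r IH] w //=.
by rewrite ler_pM2r // lerD.
Qed.

Lemma radavg_ge0 r f w : (forall w, 0 <= f w) -> 0 <= radavg r f w.
Proof.
by move=> f0; elim: r w => [|i r IH] w //=; rewrite divr_ge0 // addr_ge0.
Qed.

Lemma radavg_lin r (x y : R) f g w :
  radavg r (fun w => x * f w + y * g w) w = x * radavg r f w + y * radavg r g w.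
Proof. by elim: r w => [|i r IH] w //=; rewrite !IH; field. Qed.

Lemma radavg_sum (J : Type) (s : seq J) (P : pred J) (f : J -> V -> R) r w :
  radavg r (fun w => \sum_(j <- s | P j) f j w) w = \sum_(j <- s | P j) radavg r (f j) w.
Proof.
elim: r w => [|i r IH] w //=.
by rewrite !IH -big_split /= -mulr_suml.
Qed.

Lemma radavg_powR r f w (q : R) : 1 <= q -> (forall w, 0 <= f w) ->
  radavg r f w `^ q <= radavg r (fun w => f w `^ q) w.
Proof.
move=> q1 f0; elim: r w => [|i r IH] w //=.
apply: le_trans (powR_midpoint q1 (radavg_ge0 _ _ f0) (radavg_ge0 _ _ f0)) _.
by rewrite ler_pM2r // lerD.
Qed.

(* These hypotheses hold for the square of a Hilbert norm; [q_cross] is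
   Cauchy-Schwarz for the bilinear form obtained from [q] by polarisation. *)
Variable q : V -> R.
Hypothesis q_ge0 : forall w, 0 <= q w.
Hypothesis q_par : forall v w, q (w + v) + q (w - v) = 2 * q w + 2 * q v.
Hypothesis q_cross : forall v w, (q (w + v) - q (w - v)) ^+ 2 <= 16 * (q w * q v).

Lemma radavg_second_moment r w : radavg r q w = q w + \sum_(i <- r) q (b i).
Proof.
elim: r w => [|i r IH] w /=; first by rewrite big_nil addr0.
by rewrite !IH big_cons; have := q_par (b i) w; lra.
Qed.

(** The three terms are kept apart because the simpler bound
    [3 * (q w + \sum_i q (b i)) ^+ 2] does not pass through the induction. *)
Lemma radavg_fourth_moment r w :
  radavg r (fun w => q w ^+ 2) w <=
    q w ^+ 2 + 6 * q w * (\sum_(i <- r) q (b i)) + 3 * (\sum_(i <- r) q (b i)) ^+ 2.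
Proof.
elim: r w => [|i r IH] w /=; first by rewrite big_nil; lra.
rewrite big_cons; have H1 := IH (w + b i); have H2 := IH (w - b i).
have E := q_par (b i) w; have C := q_cross (b i) w.
have qw := q_ge0 w; have qb := q_ge0 (b i).
set s := \sum_(j <- r) q (b j) in H1 H2 *.
move: (radavg r _ (w + b i)) (radavg r _ (w - b i)) H1 H2 => A B H1 H2.
move: (q (w + b i)) (q (w - b i)) (q w) (q (b i)) E C qw qb H1 H2.
move=> x y u v E C u0 v0 H1 H2.
have xy2 : x ^+ 2 + y ^+ 2 = ((x + y) ^+ 2 + (x - y) ^+ 2) / 2 by field.
have xys : 6 * x * s + 6 * y * s = 12 * u * s + 12 * v * s.
  by rewrite -mulrDl -mulrDr E; ring.
have E2 : (x + y) ^+ 2 = 4 * u ^+ 2 + 8 * (u * v) + 4 * v ^+ 2 by rewrite E; ring.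
have -> : u ^+ 2 + 6 * u * (v + s) + 3 * (v + s) ^+ 2 =
  u ^+ 2 + 6 * (u * v) + 6 * u * s + 3 * v ^+ 2 + 6 * v * s + 3 * s ^+ 2 by ring.
have v2 := sqr_ge0 v.
rewrite E2 in xy2.
move: ((x - y) ^+ 2) C xy2 => t C xy2.
by lra.
Qed.

(** Khinchine's inequality between the first and the second moment, for a
    Hilbert norm. With [s] the square root of the second moment, averaging
    [x >= x ^+ 2 - x ^+ 4 / 6] at [x = Num.sqrt (q w) / s] and using that the
    fourth moment is at most [3 * s ^+ 4] leaves the factor
    [1 - 3 / 6]. *)
Lemma radavg_khinchine r : q 0 = 0 ->
  Num.sqrt (\sum_(i <- r) q (b i)) <= 2 * radavg r (fun w => Num.sqrt (q w)) 0.
Proof.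
move=> q00; set sg := \sum_(i <- r) q (b i).
have sg0 : 0 <= sg by apply: sumr_ge0 => i _.
have avg0 : 0 <= radavg r (fun w => Num.sqrt (q w)) 0.
  by apply: radavg_ge0 => w; exact: sqrtr_ge0.
have [->|sgn0] := eqVneq sg 0; first by rewrite sqrtr0 mulr_ge0.
set s := Num.sqrt sg.
have s2 : s ^+ 2 = sg by rewrite sqr_sqrtr.
have s0 : 0 < s by rewrite sqrtr_gt0 lt_neqAle eq_sym sgn0.
have pointwise w : s^-1 * q w + (- (6 * s ^+ 3)^-1) * (q w ^+ 2) <= Num.sqrt (q w).
  have g0 := sqrtr_ge0 (q w); have := sqr_sqrtr (q_ge0 w).
  move: (Num.sqrt (q w)) g0 => g g0 <-.
  have [x [x0 ->]] : exists x, 0 <= x /\ g = s * x.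
    exists (g / s); split; first by rewrite divr_ge0 // ltW.
    by rewrite mulrC divfK ?gt_eqF.
  have -> : s^-1 * (s * x) ^+ 2 + - (6 * s ^+ 3)^-1 * ((s * x) ^+ 2) ^+ 2 =
    s * (x ^+ 2 - x ^+ 4 / 6) by field; rewrite gt_eqF.
  rewrite ler_pM2l //.
  suff : 0 <= 1 - x + x ^+ 3 / 6.
    by move=> /(mulr_ge0 x0); lra.
  (* The minimum is at the square root of [2], close to [7 / 5]. *)
  have := mulr_ge0 (sqr_ge0 (x - 7 / 5)) (addr_ge0 x0 (ler0n R 3)).
  by nra.
have := radavg_mono r 0 pointwise.
rewrite radavg_lin radavg_second_moment q00 add0r -/sg => H.
have M4 := radavg_fourth_moment r 0; rewrite q00 -/sg in M4.
have M4' : radavg r (fun w => q w ^+ 2) 0 <= 3 * sg ^+ 2 by move: M4; lra.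
have c0 : 0 <= (6 * s ^+ 3)^-1 by rewrite invr_ge0 mulr_ge0 // exprn_ge0 // ltW.
have := ler_wpM2l c0 M4'; rewrite -s2.
have -> : (6 * s ^+ 3)^-1 * (3 * (s ^+ 2) ^+ 2) = s / 2 by field; rewrite gt_eqF.
move: H; rewrite -s2.
have -> : s^-1 * s ^+ 2 = s by field; rewrite gt_eqF.
by lra.
Qed.

End Rademacher.

Section LinearFamilies.
Variables (R : realType) (F : scalar_field) (V : lmodType (scalars R F)).
Variables (H : finType) (P : pred H) (L : H -> V -> scalars R F).
Hypothesis L_lin : forall h, scalar (L h).

Let q (w : V) := \sum_(h | P h) modulus (L h w) ^+ 2.

Let LD h v w : L h (v + w) = L h v + L h w.
Proof. by have := L_lin h 1 v w; rewrite scale1r mul1r. Qed.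

Let LB h v w : L h (v - w) = L h v - L h w.
Proof. by rewrite addrC -scaleN1r L_lin mulN1r addrC. Qed.

Lemma sum_sqr_parallelogram v w : q (w + v) + q (w - v) = 2 * q w + 2 * q v.
Proof.
rewrite /q -big_split /= !mulr_sumr -big_split /=; apply: eq_bigr => h _.
by rewrite LD LB modulus_parallelogram.
Qed.

Lemma sum_sqr_cross v w : (q (w + v) - q (w - v)) ^+ 2 <= 16 * (q w * q v).
Proof.
have q0 u : 0 <= q u by apply: sumr_ge0 => h _; exact: sqr_ge0.
have : `|q (w + v) - q (w - v)| <= 4 * (Num.sqrt (q w) * Num.sqrt (q v)).
  rewrite /q -sumrB; apply: le_trans (ler_norm_sum _ _ _) _.
  apply: le_trans (_ : _ <= 4 * \sum_(h | P h) modulus (L h w) * modulus (L h v)) _.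
    by rewrite mulr_sumr; apply: ler_sum => h _; rewrite LD LB modulus_cross.
  rewrite ler_pM2l //; apply: cauchy_schwarz_sum => h; exact: modulus_ge0.
rewrite -(ler_pXn2r (n := 2)) ?nnegrE ?mulr_ge0 ?sqrtr_ge0 //.
rewrite real_normK ?num_real // => /le_trans -> //.
by rewrite !exprMn !sqr_sqrtr //; lra.
Qed.

Lemma khinchine (I : Type) (b : I -> V) (r : seq I) :
  Num.sqrt (\sum_(i <- r) \sum_(h | P h) modulus (L h (b i)) ^+ 2) <=
  2 * radavg b r (fun w => Num.sqrt (\sum_(h | P h) modulus (L h w) ^+ 2)) 0.
Proof.
apply: (@radavg_khinchine _ _ _ b q).
- by move=> w; apply: sumr_ge0 => h _; exact: sqr_ge0.
- exact: sum_sqr_parallelogram.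
- exact: sum_sqr_cross.
- rewrite /q big1 // => h _.
  by have := LB h 0 0; rewrite !subrr => ->; rewrite modulus0 expr0n.
Qed.

End LinearFamilies.

(** * Khinchine's inequality in several variables *)

Section Box.
Variables (R : realType) (F : scalar_field) (n : nat).
Local Notation V := 'rV[scalars R F]_n.
Variable x : 'I_n -> R.
Hypothesis x_ge0 : forall v, 0 <= x v.

Definition in_box (w : V) : Prop := forall v, modulus (w 0 v) <= x v.

Definition scaled_unit (v : 'I_n) : V := of_real F (x v) *: unit_vector R F v.

Lemma scaled_unitE v j : scaled_unit v 0 j = (j == v)%:R * of_real F (x v).
Proof. by rewrite !mxE eqxx /= mulrC. Qed.

Lemma scaled_unit_in_box v : in_box (scaled_unit v).
Proof.
move=> j; rewrite scaled_unitE; case: eqP => [->|_].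
  by rewrite mul1r modulus_of_real ger0_norm.
by rewrite mul0r modulus0.
Qed.

(** All the sums with signs of the vectors [scaled_unit v] lie in the box.
    The induction needs that the coordinates still to be added vanish. *)
Lemma radavg_box (f : V -> R) (c : R) : (forall w, in_box w -> f w <= c) ->
  radavg scaled_unit (index_enum 'I_n) f 0 <= c.
Proof.
move=> fc.
have H r (w : V) : uniq r -> in_box w -> (forall v, v \in r -> w 0 v = 0) ->
    radavg scaled_unit r f w <= c.
  elim: r w => [|i r IH] w /=; first by move=> _ wb _; exact: fc.
  move=> /andP[ir ur] wb w0.
  have H (e : scalars R F) : modulus e = 1 ->
      radavg scaled_unit r f (w + e *: scaled_unit i) <= c.
    move=> e1; apply: IH => // v.
      rewrite !mxE; have [->|vi] := eqVneq v i; last by rewrite andbF !mulr0 addr0.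
      by rewrite w0 ?mem_head // add0r mulr1 modulusM e1 mul1r modulus_of_real ger0_norm.
    move=> vr; rewrite !mxE w0 ?inE ?vr ?orbT // add0r.
    have /negbTE -> : v != i by apply: contraNneq ir => <-.
    by rewrite andbF !mulr0.
  have H1 := H 1 (modulus1 _ _); rewrite scale1r in H1.
  have H2 := H (-1); rewrite modulusN modulus1 scaleN1r in H2.
  by have := H2 erefl; lra.
apply: H => [|v|v _]; rewrite ?index_enum_uniq ?mxE //.
by rewrite modulus0.
Qed.

End Box.

Section Multilinear.
Variables (R : realType) (F : scalar_field) (m n : nat).
Local Notation K := (scalars R F).
Local Notation V := 'rV[scalars R F]_n.
Variable A : ('I_m -> V) -> K.
Hypothesis A_lin : multilinear A.

Lemma dfwith_comm (z : 'I_m -> V) k l (v w : V) : k != l ->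
  dfwith (dfwith z k v) l w = dfwith (dfwith z l w) k v.
Proof.
move=> kl; apply: functional_extensionality_dep => j.
have [<-|lj] := eqVneq l j.
  by rewrite dfwithin dfwithout // dfwithin.
rewrite dfwithout //; have [<-|kj] := eqVneq k j; first by rewrite !dfwithin.
by rewrite !dfwithout.
Qed.

Lemma dfwith_id (z : 'I_m -> V) k : dfwith z k (z k) = z.
Proof.
apply: functional_extensionality_dep => j; have [<-|kj] := eqVneq k j.
  by rewrite dfwithin.
by rewrite dfwithout.
Qed.

Lemma multilinearZ z k c w : A (dfwith z k (c *: w)) = c * A (dfwith z k w).
Proof.
have A0 : A (dfwith z k 0) = 0.
  have := A_lin z k (-1) 0 0; rewrite scaleN1r oppr0 addr0 mulN1r addrC subrr.
  by [].
by rewrite -[c *: w]addr0 A_lin A0 addr0.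
Qed.

Lemma multilinear_sum z k (I : Type) (r : seq I) (w : I -> V) :
  A (dfwith z k (\sum_(i <- r) w i)) = \sum_(i <- r) A (dfwith z k (w i)).
Proof.
elim: r => [|i r IH]; rewrite ?big_nil ?big_cons.
  by rewrite -(scale0r 0) multilinearZ mul0r.
by rewrite -IH -[w i]scale1r A_lin mul1r scale1r.
Qed.

Lemma multilinear_scale (c : 'I_m -> K) (z : 'I_m -> V) :
  A (fun k => c k *: z k) = (\prod_k c k) * A z.
Proof.
have H r : uniq r -> A (fun k => if k \in r then c k *: z k else z k) =
    (\prod_(k <- r) c k) * A z.
  elim: r => [|k r IH] /=; first by rewrite big_nil mul1r.
  move=> /andP[kr ur]; rewrite big_cons -mulrA -IH //.
  pose z' j := if j \in r then c j *: z j else z j.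
  have -> : c k * A z' = A (dfwith z' k (c k *: z' k)).
    by rewrite multilinearZ dfwith_id.
  rewrite {2}/z' (negbTE kr); congr A; apply: functional_extensionality_dep => j; rewrite inE.
  have [->|jk] := eqVneq j k; first by rewrite dfwithin.
  by rewrite dfwithout // eq_sym.
rewrite -(H _ (index_enum_uniq _)); congr A.
by apply: functional_extensionality_dep => k; rewrite mem_index_enum.
Qed.

Variable x : 'I_m -> 'I_n -> R.
Hypothesis x_ge0 : forall k v, 0 <= x k v.
Variable C : R.
Hypothesis A_le : forall z, (forall k, in_box (x k) (z k)) -> modulus (A z) <= C.

Local Notation e k v := (scaled_unit F (x k) v).

(** The squared [l_2] norm of the coefficients in the variables [ks]; the other
    variables keep their values in [z], so that they can still be averaged. *)
Fixpoint partial_sqr (ks : seq 'I_m) (z : 'I_m -> V) : R :=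
  if ks is k :: ks' then \sum_v partial_sqr ks' (dfwith z k (e k v))
  else modulus (A z) ^+ 2.

(** What makes Khinchine's inequality applicable in a further variable: as a
    function of that variable, [partial_sqr] is a squared Hilbert norm. *)
Lemma partial_sqr_linear ks : exists H : finType, forall z k, k \notin ks ->
  exists2 L : H -> V -> K, forall h, scalar (L h) &
    forall w, partial_sqr ks (dfwith z k w) = \sum_h modulus (L h w) ^+ 2.
Proof.
elim: ks => [|k' ks [H IH]].
  exists unit => z k _; exists (fun _ w => A (dfwith z k w)) => [_|w].
    exact: A_lin.
  by rewrite big_const card_unit /= addr0.
exists ('I_n * H)%type => z k; rewrite inE negb_or => /andP[kk' kks].
have /choice[L HL] : forall v, exists L : H -> V -> K, (forall h, scalar (L h)) /\
    forall w, partial_sqr ks (dfwith (dfwith z k' (e k' v)) k w) =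
      \sum_h modulus (L h w) ^+ 2.
  by move=> v; have [L L1 L2] := IH (dfwith z k' (e k' v)) k kks; exists L.
exists (fun vh => L vh.1 vh.2) => [[v h]|w] /=; first by have [] := HL v.
rewrite -(pair_bigA _ (fun v h => modulus (L v h w) ^+ 2)) /=.
by apply: eq_bigr => v _; rewrite dfwith_comm //; have [_ ->] := HL v.
Qed.

Lemma in_box_dfwith (z : 'I_m -> V) k w : (forall j, in_box (x j) (z j)) ->
  in_box (x k) w -> forall j, in_box (x j) (dfwith z k w j).
Proof.
move=> zb wb j; have [<-|kj] := eqVneq k j; first by rewrite dfwithin.
by rewrite dfwithout.
Qed.

(** Each variable of [ks] costs a factor [2] by Khinchine's inequality; the
    average commutes with the sum over [v], so the same signs serve all [v]. In
    the variable [l] phases turn the sum of the moduli into a single value of the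
    form. *)
Lemma iterated_khinchine ks l z : uniq ks -> l \notin ks ->
  (forall k, in_box (x k) (z k)) ->
  \sum_v Num.sqrt (partial_sqr ks (dfwith z l (e l v))) <= 2 ^+ size ks * C.
Proof.
elim: ks z => [|k ks IH] z /=.
  move=> _ _ zb; rewrite mul1r.
  under eq_bigr => v _ do rewrite sqrtr_sqr ger0_norm ?modulus_ge0 //.
  have /choice[u Hu] : forall v, exists u : K, modulus u <= 1 /\
      u * A (dfwith z l (e l v)) = of_real F (modulus (A (dfwith z l (e l v)))).
    by move=> v; have [u u1 u2] := unimodular_phase (A (dfwith z l (e l v))); exists u.
  set w : V := \sum_v u v *: e l v.
  have wb : in_box (x l) w.
    move=> v; rewrite summxE (bigD1 v) //= big1 ?addr0 => [|j jv].
      rewrite mxE scaled_unitE eqxx mul1r modulusM modulus_of_real ger0_norm //.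
      by rewrite ler_piMl //; have [] := Hu v.
    by rewrite mxE scaled_unitE eq_sym (negbTE jv) mul0r mulr0.
  have := A_le (in_box_dfwith zb wb).
  rewrite multilinear_sum.
  rewrite (eq_bigr (fun v => of_real F (modulus (A (dfwith z l (e l v)))))); last first.
    by move=> v _; rewrite multilinearZ; have [_ ->] := Hu v.
  by rewrite -of_real_sum modulus_of_real ger0_norm // sumr_ge0 // => v _; exact: modulus_ge0.
move=> /andP[kks uks]; rewrite inE negb_or => /andP[lk lks] zb.
have [H HL] := partial_sqr_linear ks.
apply: (@le_trans _ _ (2 * radavg (fun v => e k v) (index_enum 'I_n)
  (fun w => \sum_v Num.sqrt (partial_sqr ks (dfwith (dfwith z k w) l (e l v)))) 0)).
  rewrite radavg_sum mulr_sumr; apply: ler_sum => v _.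
  have [L L1 L2] := HL (dfwith z l (e l v)) k kks.
  under eq_bigr => j _ do rewrite L2.
  apply: le_trans (khinchine predT L1 (fun v => e k v) (index_enum 'I_n)) _.
  rewrite ler_pM2l //; apply: radavg_mono => w.
  by rewrite -L2 (dfwith_comm _ _ _ lk).
rewrite exprS -mulrA ler_pM2l //.
apply: radavg_box => // w wb; apply: IH => //.
exact: in_box_dfwith.
Qed.

Lemma partial_sqrE ks (g : m.-tuple 'I_n) : uniq ks ->
  partial_sqr ks (fun k => e k (tnth g k)) =
  \sum_(j : m.-tuple 'I_n | [forall k, (k \notin ks) ==> (tnth j k == tnth g k)])
     modulus (A (fun k => e k (tnth j k))) ^+ 2.
Proof.
elim: ks g => [|k ks IH] g /=.
  move=> _; rewrite (big_pred1 g) // => j; apply/forallP/eqP => [H|-> k]; last by rewrite eqxx.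
  by apply: eq_from_tnth => k; have /eqP := H k.
move=> /andP[kks uks].
rewrite [RHS](partition_big (fun j : m.-tuple 'I_n => tnth j k) predT) //=.
apply: eq_bigr => v _.
pose g' := [tuple if i == k then v else tnth g i | i < m].
have -> : dfwith (fun k => e k (tnth g k)) k (e k v) = fun k => e k (tnth g' k).
  apply: functional_extensionality_dep => i; rewrite tnth_mktuple.
  have [->|ik] := eqVneq i k; first by rewrite dfwithin.
  by rewrite dfwithout // eq_sym.
rewrite IH //; apply: eq_bigl => j; apply/forallP/andP => [H|[/forallP H /eqP jk] i].
  split; last by have := H k; rewrite kks tnth_mktuple eqxx.
  apply/forallP => i; apply/implyP; rewrite inE negb_or => /andP[ik iks].
  by have := H i; rewrite iks tnth_mktuple (negbTE ik).
apply/implyP => iks; rewrite tnth_mktuple; have [->|ik] := eqVneq i k; first by apply/eqP.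
by have := H i; rewrite inE (negbTE ik) iks.
Qed.

Lemma multiple_khinchine l :
  \sum_v slice_norm (fun l (j : m.-tuple 'I_n) => tnth j l)
    (fun j => modulus (A (fun k => unit_vector R F (tnth j k))) *
              \prod_k x k (tnth j k)) l v <= 2 ^+ m.-1 * C.
Proof.
have [n0|n_gt0] := posnP n.
  rewrite big1 => [|v _]; last by have := ltn_ord v; rewrite {2}n0.
  apply: mulr_ge0; first by rewrite exprn_ge0.
  apply: le_trans (A_le (z := fun=> 0) _); first exact: modulus_ge0.
  by move=> k v; have := ltn_ord v; rewrite {2}n0.
pose v0 := Ordinal n_gt0.
pose ks := rem l (index_enum 'I_m).
have ks_size : size ks = m.-1.
  by rewrite size_rem ?mem_index_enum // -[in RHS](card_ord m) cardE enumT.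
have ks_uniq : uniq ks by rewrite rem_uniq // index_enum_uniq.
have ks_mem k : (k \in ks) = (k != l).
  by rewrite /ks rem_filter ?index_enum_uniq // mem_filter mem_index_enum andbT.
have lks : l \notin ks by rewrite ks_mem eqxx.
have := iterated_khinchine (z := fun k => e k v0) ks_uniq lks
  (fun k => @scaled_unit_in_box _ _ _ _ (x_ge0 k) v0).
rewrite ks_size; apply: le_trans; apply: ler_sum => v _.
pose g := [tuple if i == l then v else v0 | i < m].
have -> : dfwith (fun k => e k v0) l (e l v) = fun k => e k (tnth g k).
  apply: functional_extensionality_dep => i; rewrite tnth_mktuple.
  have [->|il] := eqVneq i l; first by rewrite dfwithin.
  by rewrite dfwithout // eq_sym.
rewrite partial_sqrE // /slice_norm.
apply: le_eqW; congr Num.sqrt; symmetry.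
apply: eq_big => [j|j _].
  apply/forallP/idP => [/(_ l)|/eqP jl k].
    by rewrite lks tnth_mktuple eqxx.
  rewrite ks_mem negbK; apply/implyP => /eqP ->.
  by rewrite tnth_mktuple eqxx jl.
congr (_ ^+ 2).
rewrite multilinear_scale modulusM modulus_prod mulrC; congr (_ * _).
by apply: eq_bigr => k _; rewrite modulus_of_real ger0_norm.
Qed.

End Multilinear.

(** * Mixed sums *)

Section NestedSums.
Variables (R : realType) (n : nat).

Lemma nested_sum_ge0 m (r : R) (t : 'I_m -> R) a : 0 <= @nested_sum R n m r t a.
Proof. by case: m t a => [|m] t a /=; exact: powR_ge0. Qed.

Lemma nested_sum_powR m (r : R) (t : 'I_m -> R) (a : m.-tuple 'I_n -> R) :
  (forall js, 0 <= a js) -> nested_sum r t a = nested_sum 1 t a `^ r.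
Proof.
case: m t a => [|m] t a a0 /=; first by rewrite powRr1.
by rewrite -powRrM mul1r mulrC.
Qed.

Lemma nested_sum_scale m (r c : R) (t : 'I_m -> R) (a : m.-tuple 'I_n -> R) :
  0 <= c -> (forall k, 0 < t k) -> (forall js, 0 <= a js) ->
  nested_sum r t (fun js => c * a js) = c `^ r * nested_sum r t a.
Proof.
move=> c0; elim: m r t a => [|m IH] r t a t0 a0 /=; first by rewrite powRM.
have S0 : 0 <= \sum_(j < n) nested_sum (t ord0) (fun k => t (lift ord0 k))
    (fun js => a [tuple of j :: js]) by apply: sumr_ge0 => j _; exact: nested_sum_ge0.
under eq_bigr => j _ do rewrite (IH _ _ (fun js => a [tuple of j :: js])) //.
rewrite -mulr_sumr powRM ?powR_ge0 // -powRrM.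
by rewrite [t ord0 * _]mulrC divfK ?gt_eqF.
Qed.

Lemma sum_tuple_head m (f : m.+1.-tuple 'I_n -> R) v :
  \sum_(js : m.+1.-tuple 'I_n | tnth js ord0 == v) f js =
  \sum_(js : m.-tuple 'I_n) f [tuple of v :: js].
Proof.
rewrite (reindex_onto (fun js : m.-tuple 'I_n => [tuple of v :: js])
  (fun js : m.+1.-tuple 'I_n => [tuple of behead js])) /=; last first.
  by move=> js /eqP <-; apply: val_inj; rewrite [in RHS](tuple_eta js).
apply: eq_bigl => js; rewrite tnth0 eqxx /=; apply/eqP; exact: val_inj.
Qed.

Lemma nested_sum_sqr m (r : R) (a : m.-tuple 'I_n -> R) :
  (forall js, 0 <= a js) ->
  nested_sum r (fun=> 2) a = (\sum_(js : m.-tuple 'I_n) a js ^+ 2) `^ (r / 2).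
Proof.
elim: m r a => [|m IH] r a a0 /=.
  rewrite (big_pred1 [tuple]) => [|js]; last by rewrite [js]tuple0; apply/esym/eqP.
  by rewrite -powR_mulrn // -powRrM mulrC divfK.
congr (_ `^ _).
rewrite [RHS](partition_big (fun js => tnth js ord0) predT) //=.
apply: eq_bigr => j _; rewrite sum_tuple_head IH // divff // powRr1 //.
by apply: sumr_ge0 => js _; exact: sqr_ge0.
Qed.

(** The mixed norm with exponents [t] has cotype [r] with constant one. At
    every level the power [r / t ord0 >= 1] is superadditive on the left and
    convex on the right, which reduces the claim to the exponent [t ord0], and
    there the sum over the first index commutes with both sides. What remains
    is the second moment of the scalars. *)
Lemma nested_sum_cotype (F : scalar_field) (V : lmodType (scalars R F))
    (I : Type) (b : I -> V) (s : seq I) m (r : R) (t : 'I_m -> R)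
    (L : m.-tuple 'I_n -> V -> scalars R F) :
  (forall js, scalar (L js)) -> 2 <= r -> (forall k, 2 <= t k <= r) ->
  (forall k l : 'I_m, (k <= l)%N -> t l <= t k) ->
  \sum_(i <- s) nested_sum r t (fun js => modulus (L js (b i))) <=
  radavg b s (fun w => nested_sum r t (fun js => modulus (L js w))) 0.
Proof.
have step (G : V -> R) (q : R) : 1 <= q -> (forall w, 0 <= G w) ->
    \sum_(i <- s) G (b i) <= radavg b s G 0 ->
    \sum_(i <- s) G (b i) `^ q <= radavg b s (fun w => G w `^ q) 0.
  move=> q1 G0 H; apply: le_trans (sum_powR_le _ _ q1 (fun i => G0 (b i))) _.
  apply: le_trans (radavg_powR b s 0 q1 G0).
  apply: powR_le_mono H; first exact: le_trans q1.
  by apply: sumr_ge0 => i _.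
elim: m r t L => [|m IH] r t L L_lin r2 t2 t_mono /=.
  have -> : (fun w => modulus (L [tuple] w) `^ r) =
      (fun w => (modulus (L [tuple] w) ^+ 2) `^ (r / 2)).
    apply: functional_extensionality_dep => w.
    by rewrite -powR_mulrn ?modulus_ge0 // -powRrM mulrC divfK.
  have -> : \sum_(i <- s) modulus (L [tuple] (b i)) `^ r =
      \sum_(i <- s) (modulus (L [tuple] (b i)) ^+ 2) `^ (r / 2).
    apply: eq_bigr => i _.
    by rewrite -powR_mulrn ?modulus_ge0 // -powRrM mulrC divfK.
  apply: (step (fun w => modulus (L [tuple] w) ^+ 2)).
  - by rewrite ler_pdivlMr // mul1r.
  - by move=> w; exact: sqr_ge0.
  have par := sum_sqr_parallelogram (H := unit) predT (fun _ => L_lin [tuple]).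
  have E w : \sum_(h : unit) modulus (L [tuple] w) ^+ 2 = modulus (L [tuple] w) ^+ 2.
    by rewrite big_const card_unit /= addr0.
  rewrite (radavg_second_moment b (q := fun w => modulus (L [tuple] w) ^+ 2)).
    by rewrite lerDr sqr_ge0.
  by move=> v w; have := par v w; rewrite !E.
have /andP[t02 t0r] := t2 ord0.
have t00 : 0 < t ord0 by exact: lt_le_trans t02.
apply: (step (fun w => \sum_(j < n) nested_sum (t ord0)
    (fun k => t (lift ord0 k)) (fun js => modulus (L [tuple of j :: js] w)))).
- by rewrite ler_pdivlMr // mul1r.
- by move=> w; apply: sumr_ge0 => j _; exact: nested_sum_ge0.
rewrite exchange_big /= radavg_sum; apply: ler_sum => j _.
apply: (IH _ _ (fun js => L [tuple of j :: js])) => // [k|k l kl].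
  by have /andP[-> _] := t2 (lift ord0 k); exact: t_mono.
by apply: t_mono; rewrite /= /bump /= !add1n ltnS.
Qed.

End NestedSums.

(** * The exponents *)

Section Exponents.
Variables (R : realType).

Lemma hl_exponent_lift m (p : 'I_m.+1 -> \bar R) (i : 'I_m) :
  (fun k : 'I_m => hl_exponent p (lift ord0 i) (lift ord0 k)) =
  hl_exponent (fun k => p (lift ord0 k)) i.
Proof.
apply: functional_extensionality_dep => k; rewrite /hl_exponent /= /bump /= !add1n ltnS.
case: ifP => // _; congr ((1 - _)^-1).
by rewrite big_mkcond big_ord_recl /= add0r -big_mkcond.
Qed.

Lemma hl_exponent_first m (p : 'I_m.+1 -> \bar R) i :
  hl_exponent p i ord0 = (1 - \sum_l recip (p l))^-1.
Proof. by []. Qed.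

Variables (m : nat) (p : 'I_m -> \bar R) (i : 'I_m).
Hypothesis p1 : forall k, (1 <= p k)%E.
Hypothesis sum_lt1 : \sum_k recip (p k) < 1.
Hypothesis pi2 : (p i <= 2%:E)%E.

Lemma recip_ge_half : 2^-1 <= recip (p i).
Proof.
have := p1 i; move: pi2; case: (p i) => [r|//|//].
rewrite !lee_fin => r2 r1; rewrite recipE // lef_pV2 ?posrE //.
exact: lt_le_trans r1.
Qed.

Let tail (k : nat) := \sum_(l < m | (k <= l)%N) recip (p l).

Let tail_mono (k l : nat) : (k <= l)%N -> tail l <= tail k.
Proof.
move=> kl; rewrite /tail big_mkcond [leRHS]big_mkcond /=; apply: ler_sum => j _.
case: ifP => [lj|_]; first by rewrite (leq_trans kl lj).
by case: ifP => // _; exact: recip_ge0.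
Qed.

Let tail_lt1 k : tail k < 1.
Proof.
by apply: le_lt_trans sum_lt1; apply: le_trans (tail_mono (leq0n k)) _.
Qed.

Let tail_ge k : (k <= i)%N -> 2^-1 <= tail k.
Proof.
move=> ki; apply: le_trans recip_ge_half _.
by rewrite /tail (bigD1 i) //= lerDl sumr_ge0 // => j _; exact: recip_ge0.
Qed.

Let inv_mono (x y : R) : x <= y -> y < 1 -> (1 - x)^-1 <= (1 - y)^-1.
Proof.
move=> xy y1; rewrite lef_pV2 ?posrE ?subr_gt0 //; first by rewrite lerD2l lerN2.
exact: le_lt_trans y1.
Qed.

Lemma hl_exponent_ge2 k : 2 <= hl_exponent p i k.
Proof.
rewrite /hl_exponent; case: ifP => [ki|//].
have -> : 2 = (1 - 2^-1)^-1 :> R by field.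
exact: inv_mono (tail_ge ki) (tail_lt1 k).
Qed.

Lemma hl_exponent_mono (k l : 'I_m) : (k <= l)%N -> hl_exponent p i l <= hl_exponent p i k.
Proof.
move=> kl; rewrite {1}/hl_exponent; case: ifP => [li|_]; last exact: hl_exponent_ge2.
rewrite /hl_exponent (leq_trans kl li).
exact: inv_mono (tail_mono kl) (tail_lt1 k).
Qed.

Lemma hl_exponent_le k : hl_exponent p i k <= (1 - \sum_l recip (p l))^-1.
Proof.
have E : \sum_l recip (p l) = tail 0 by [].
rewrite /hl_exponent; case: ifP => _; rewrite E.
  exact: inv_mono (tail_mono (leq0n k)) (tail_lt1 0).
have -> : 2 = (1 - 2^-1)^-1 :> R by field.
exact: inv_mono (tail_ge (leq0n i)) (tail_lt1 0).
Qed.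

End Exponents.

(** * The mixed sum estimate *)

Section UpperBound.
Variables (R : realType) (F : scalar_field) (n : nat).
Local Notation K := (scalars R F).
Local Notation V := 'rV[scalars R F]_n.

Definition bounded_on_ball m (p : 'I_m -> \bar R) (A : ('I_m -> V) -> K) (C : R) :=
  forall z, (forall k, lp_norm (p k) (z k) <= 1) -> modulus (A z) <= C.

Lemma lp_norm_in_box (p : \bar R) (x : 'I_n -> R) (w : V) : (1 <= p)%E ->
  in_lp_ball p x -> in_box x w -> lp_norm p w <= 1.
Proof.
move=> p1 xb wx; apply/lp_norm_le1 => //; apply: in_lp_ball_le xb => // v.
by rewrite modulus_ge0 wx.
Qed.

Lemma lp_norm0_le1 (p : \bar R) : (1 <= p)%E -> lp_norm p (0 : V) <= 1.
Proof.
move=> p1; apply: (lp_norm_in_box (x := fun=> 0)) => // [|v]; last first.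
  by rewrite mxE modulus0.
case: p p1 => [r|_ v|//] //=; rewrite lee_fin => r1.
by rewrite big1 // => v _; rewrite powR0 // gt_eqF // (lt_le_trans _ r1).
Qed.

Lemma bounded_on_ball_ge0 m (p : 'I_m -> \bar R) A C : (forall k, (1 <= p k)%E) ->
  bounded_on_ball p A C -> 0 <= C.
Proof.
move=> p1 /(_ (fun=> 0)) H; apply: le_trans (modulus_ge0 _) (H _) => k.
exact: lp_norm0_le1.
Qed.

Lemma form_norm_ge0 m (p : 'I_m -> \bar R) (A : ('I_m -> V) -> K) :
  (forall k, (1 <= p k)%E) -> (0 <= form_norm p A)%E.
Proof.
move=> p1; apply: le_trans (_ : (modulus (A (fun=> 0)))%:E <= _)%E.
  by rewrite lee_fin modulus_ge0.
by apply: ereal_sup_ubound; exists (fun=> 0) => // l; exact: lp_norm0_le1.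
Qed.

Lemma multiple_khinchine_lp m (p : 'I_m -> \bar R) A C (x : 'I_m -> 'I_n -> R) :
  (forall k, (1 <= p k)%E) -> multilinear A -> bounded_on_ball p A C ->
  (forall k v, 0 <= x k v) -> (forall k, in_lp_ball (p k) (x k)) -> forall l,
  \sum_v slice_norm (fun l (j : m.-tuple 'I_n) => tnth j l)
    (fun j => modulus (A (fun k => unit_vector R F (tnth j k))) *
              \prod_k x k (tnth j k)) l v <= 2 ^+ m.-1 * C.
Proof.
move=> p1 A_lin A_bd x0 xb l; apply: multiple_khinchine => // z zb.
by apply: A_bd => k; exact: lp_norm_in_box (zb k).
Qed.

(** The slice estimate is used with [+oo] in place of [p ord0], for the
    coefficients multiplied by a weight [y] in the unit ball of [l_(p ord0)]; then
    the supremum over [y] brings [p ord0] back. *)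
Lemma mixed_sum_bound_first m (p : 'I_m.+1 -> \bar R) A C :
  (forall k, (1 <= p k)%E) -> \sum_k recip (p k) < 1 -> (p ord0 <= 2%:E)%E ->
  multilinear A -> bounded_on_ball p A C ->
  coef_mixed_sum (hl_exponent p ord0) A <= 2 ^+ m * C.
Proof.
move=> p1 sum1 p2 A_lin A_bd.
have C0 := bounded_on_ball_ge0 p1 A_bd.
have D0 : 0 <= 2 ^+ m * C by rewrite mulr_ge0 // exprn_ge0.
pose a (j : m.+1.-tuple 'I_n) := modulus (A (fun k => unit_vector R F (tnth j k))).
have a0 j : 0 <= a j by exact: modulus_ge0.
pose pr (l : 'I_m.+1) (j : m.+1.-tuple 'I_n) := tnth j l.
pose S v := slice_norm pr a ord0 v.
have S0 v : 0 <= S v by exact: sqrtr_ge0.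
pose q (k : 'I_m.+1) : \bar R := if k == ord0 then +oo%E else p k.
have q1 k : (1 <= q k)%E by rewrite /q; case: ifP => // _; rewrite leey.
pose rho := \sum_k recip (q k).
have sum_rho : \sum_k recip (p k) = recip (p ord0) + rho.
  rewrite /rho !big_ord_recl /= {1}/q eqxx recipy add0r; congr (_ + _).
have half := recip_ge_half p1 p2.
have rho_half : rho <= 2^-1 by move: sum1; rewrite sum_rho; lra.
set s := hl_exponent p ord0 ord0.
have sE : s^-1 = 1 - \sum_k recip (p k) by rewrite /s hl_exponent_first invrK.
have s0 : 0 < s by rewrite -invr_gt0 sE subr_gt0.
have u0 : 0 < (1 - rho)^-1 by rewrite invr_gt0; lra.
have key : \sum_v S v `^ s <= (2 ^+ m * C) `^ s.
  apply: (lp_weights_dual (p1 ord0) u0) => // [|y y0 yb].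
    by rewrite invrK sE sum_rho; ring.
  have := @hardy_littlewood_slices R 'I_m.+1 'I_n _ pr q
    (fun j => a j * y (pr ord0 j)) (2 ^+ m * C) q1 _ rho_half.
  move=> /(_ (fun j => mulr_ge0 (a0 j) (y0 _))) H.
  have {}H := H _ ord0.
  have E v : slice_norm pr (fun j => a j * y (pr ord0 j)) ord0 v = y v * S v.
    rewrite /S /slice_norm -[y v]ger0_norm // -sqrtr_sqr -sqrtrM ?sqr_ge0 //.
    congr Num.sqrt; rewrite mulr_sumr; apply: eq_bigr => j /eqP ->.
    by rewrite exprMn mulrC.
  under eq_bigr => v _ do rewrite -E.
  apply: H => x x0 xb l.
  pose x' k v := if k == ord0 then x k v * y v else x k v.
  have := @multiple_khinchine_lp _ p A C x' p1 A_lin A_bd _ _ l.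
  have x'0 k v : 0 <= x' k v by rewrite /x'; case: ifP => _ //; rewrite mulr_ge0.
  move=> /(_ x'0) H'; apply: le_trans (H' _); last first.
    move=> k; rewrite /x'; have := xb k; rewrite /q; have [->|_] := eqVneq k ord0; last by [].
    move=> x1; apply: in_lp_ball_le yb => // v.
    by rewrite mulr_ge0 //= ler_piMl.
  apply: ler_sum => v _; apply: le_eqW.
  congr Num.sqrt; apply: eq_bigr => j _; congr (_ ^+ 2); rewrite -/(a j) -mulrA.
  congr (_ * _); rewrite !big_ord_recl /x' eqxx /= mulrA [y _ * _]mulrC.
  by congr (_ * _).
rewrite /coef_mixed_sum -/a /= -/s.
have -> : \sum_(j < n) nested_sum s (fun k : 'I_m => hl_exponent p ord0 (lift ord0 k))
    (fun js => a [tuple of j :: js]) = \sum_v S v `^ s.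
  apply: eq_bigr => v _.
  have -> : (fun k : 'I_m => hl_exponent p ord0 (lift ord0 k)) = (fun=> 2) by [].
  rewrite nested_sum_sqr // -(sum_tuple_head (fun j => a j ^+ 2)).
  have S2 : \sum_(j | pr ord0 j == v) a j ^+ 2 = S v ^+ 2.
    by rewrite sqr_sqrtr // sumr_ge0 // => j _; exact: sqr_ge0.
  by rewrite S2 -powR_mulrn // -powRrM mulrC divfK.
have := powR_le_mono (q := 1 / s) _ _ key.
rewrite -powRrM [s * _]mulrC divfK ?gt_eqF // powRr1 //; apply.
  by rewrite divr_ge0 // ltW.
by apply: sumr_ge0 => v _; exact: powR_ge0.
Qed.

Definition vcons m (w : V) (z : 'I_m -> V) : 'I_m.+1 -> V :=
  fun k => if unlift ord0 k is Some k' then z k' else w.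

Lemma vcons0 m w (z : 'I_m -> V) : vcons w z ord0 = w.
Proof. by rewrite /vcons unlift_none. Qed.

Lemma vcons_lift m w (z : 'I_m -> V) k : vcons w z (lift ord0 k) = z k.
Proof. by rewrite /vcons liftK. Qed.

Lemma ord_lift0 m (P : 'I_m.+1 -> Prop) :
  P ord0 -> (forall k, P (lift ord0 k)) -> forall k, P k.
Proof. by move=> P0 PS k; case: (unliftP ord0 k) => [j|] ->. Qed.

Lemma multilinear_head m (A : ('I_m.+1 -> V) -> K) z : multilinear A ->
  scalar (fun w => A (vcons w z)).
Proof.
have E w : vcons w z = dfwith (vcons 0 z) ord0 w.
  apply: functional_extensionality_dep; apply: ord_lift0 => [|k].
    by rewrite vcons0 dfwithin.
  by rewrite dfwithout // !vcons_lift.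
by move=> A_lin c v w; rewrite (E (_ + _)) (E v) (E w); exact: A_lin.
Qed.

Lemma multilinear_tail m (A : ('I_m.+1 -> V) -> K) w : multilinear A ->
  multilinear (fun z => A (vcons w z)).
Proof.
move=> A_lin z k.
have E x : vcons w (dfwith z k x) = dfwith (vcons w z) (lift ord0 k) x.
  apply: functional_extensionality_dep; apply: ord_lift0 => [|j].
    by rewrite dfwithout // !vcons0.
  rewrite vcons_lift; have [<-|kj] := eqVneq k j; first by rewrite !dfwithin.
  by rewrite !dfwithout ?vcons_lift // (inj_eq lift_inj).
by move=> c x y; rewrite !E; exact: A_lin.
Qed.

(** Adding a variable in front: [N w] is the mixed sum of the form with first
    argument [w], bounded by induction for [w] in the unit ball. Cotype, applied to
    the weighted unit vectors, bounds the sum of [(x v * N (e v)) `^ u] for all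
    weights [x], and duality raises [u] to [s]. *)
Lemma mixed_sum_bound m (p : 'I_m -> \bar R) (i : 'I_m) A C :
  (forall k, (1 <= p k)%E) -> \sum_k recip (p k) < 1 -> (p i <= 2%:E)%E ->
  multilinear A -> bounded_on_ball p A C ->
  coef_mixed_sum (hl_exponent p i) A <= 2 ^+ m * C.
Proof.
elim: m p i A C => [|m IH] p i A C; first by case: i.
case: (unliftP ord0 i) => [i'|] ->; last first.
  move=> p1 sum1 p2 A_lin A_bd.
  apply: le_trans (mixed_sum_bound_first p1 sum1 p2 A_lin A_bd) _.
  rewrite ler_wpM2r ?(bounded_on_ball_ge0 p1 A_bd) // exprS ler_peMl ?exprn_ge0 //.
  by rewrite ler1n.
move=> p1 sum1 p2 A_lin A_bd.
have C0 := bounded_on_ball_ge0 p1 A_bd.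
have D0 : 0 <= 2 ^+ m * C by rewrite mulr_ge0 // exprn_ge0.
pose p' k := p (lift ord0 k); pose t' := hl_exponent p' i'.
have sumE : \sum_k recip (p k) = recip (p ord0) + \sum_k recip (p' k).
  by rewrite big_ord_recl.
have p'1 k : (1 <= p' k)%E by exact: p1.
have sum1' : \sum_k recip (p' k) < 1.
  by move: sum1; rewrite sumE; have := recip_ge0 (p1 ord0); lra.
pose L (js : m.-tuple 'I_n) (w : V) := A (vcons w (fun k => unit_vector R F (tnth js k))).
have L_lin js : scalar (L js) by exact: multilinear_head.
pose N w := nested_sum 1 t' (fun js => modulus (L js w)).
have N_le w : lp_norm (p ord0) w <= 1 -> N w <= 2 ^+ m * C.
  move=> w1; apply: (IH p' i' (fun z => A (vcons w z)) C) => //.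
    exact: multilinear_tail.
  move=> z z1; apply: A_bd; apply: ord_lift0 => [|k]; first by rewrite vcons0.
  by rewrite vcons_lift; exact: z1.
have t'2 k : 2 <= t' k by exact: hl_exponent_ge2.
pose u := (1 - \sum_k recip (p' k))^-1.
have t'u k : t' k <= u by exact: hl_exponent_le.
have u0 : 0 < u by rewrite invr_gt0 subr_gt0.
set s := hl_exponent p (lift ord0 i') ord0.
have sE : s^-1 = 1 - \sum_k recip (p k) by rewrite /s hl_exponent_first invrK.
have s0 : 0 < s by rewrite -invr_gt0 sE subr_gt0.
pose b v := N (unit_vector R F v).
have b0 v : 0 <= b v by exact: nested_sum_ge0.
have key : \sum_v b v `^ s <= (2 ^+ m * C) `^ s.
  apply: (lp_weights_dual (p1 ord0) u0) => // [|x x0 xb].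
    by rewrite sE /u invrK sumE; ring.
  apply: (@le_trans _ _ (\sum_v nested_sum u t'
      (fun js => modulus (L js (scaled_unit F x v))))).
    apply: ler_sum => v _; rewrite nested_sum_powR; last by move=> js; exact: modulus_ge0.
    apply: le_eqW; congr (_ `^ _).
    rewrite -[x v]powRr1 // -nested_sum_scale //; last 2 first.
    - by move=> k; exact: lt_le_trans (t'2 k).
    - by move=> js; exact: modulus_ge0.
    congr nested_sum; apply: functional_extensionality_dep => js.
    have L0 : L js 0 = 0.
      by have := L_lin js (-1) 0 0; rewrite scaler0 addr0 mulN1r addNr.
    rewrite /scaled_unit -[_ *: _]addr0 L_lin L0 addr0 modulusM modulus_of_real.
    by rewrite ger0_norm.
  apply: le_trans (nested_sum_cotype (scaled_unit F x) (index_enum 'I_n) L_lin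
    (r := u) (t := t') _ _ _) _.
  - exact: le_trans (t'2 i') (t'u i').
  - by move=> k; rewrite t'2 t'u.
  - by move=> k l; exact: hl_exponent_mono.
  apply: radavg_box => // w wx.
  rewrite nested_sum_powR; last by move=> js; exact: modulus_ge0.
  apply: powR_le_mono; [exact: ltW|exact: nested_sum_ge0|].
  exact/N_le/(lp_norm_in_box (p1 ord0) xb).
apply: (@le_trans _ _ (2 ^+ m * C)); last first.
  by rewrite ler_wpM2r // exprS ler_peMl ?exprn_ge0 // ler1n.
rewrite /coef_mixed_sum /= hl_exponent_lift -/s -/t'.
have -> : \sum_(j < n) nested_sum s t' (fun js => modulus
     (A (fun k => unit_vector R F (tnth [tuple of j :: js] k)))) = \sum_v b v `^ s.
  apply: eq_bigr => v _; rewrite nested_sum_powR; last by move=> js; exact: modulus_ge0.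
  congr (nested_sum _ _ _ `^ _); apply: functional_extensionality_dep => js.
  congr (modulus (A _)); apply: functional_extensionality_dep.
  apply: ord_lift0 => [|k]; first by rewrite vcons0.
  by rewrite vcons_lift tnthS.
have := powR_le_mono (q := 1 / s) _ _ key.
rewrite -powRrM [s * _]mulrC divfK ?gt_eqF // powRr1 //; apply.
  by rewrite divr_ge0 // ltW.
by apply: sumr_ge0 => v _; exact: powR_ge0.
Qed.

End UpperBound.

(** * Optimality of the exponents *)

Section Optimality.
Variable R : realType.

(** The contradiction comes from an [n] beyond [C `^ (a - b)^-1]. *)
Lemma powR_growth (a b C : R) : 0 <= C ->
  (forall n, (0 < n)%N -> n%:R `^ a <= C * n%:R `^ b) -> a <= b.
Proof.
move=> C0 H; rewrite leNgt; apply/negP => ba.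
have d0 : 0 < a - b by rewrite subr_gt0.
pose x := C `^ (a - b)^-1; have x0 : 0 <= x by exact: powR_ge0.
pose n := Num.bound x; have xn : x < n%:R by exact: archi_boundP.
have n0 : 0 < n%:R :> R by exact: le_lt_trans xn.
have := H n; rewrite -(ltr0n R) => /(_ n0).
rewrite -ler_pdivrMr ?powR_gt0 // -powRB ?(gt_eqF n0) ?implybT //.
have -> : C = x `^ (a - b) by rewrite -powRrM mulVf ?gt_eqF // powRr1.
by apply/negP; rewrite -ltNge; apply: gt0_ltr_powR; rewrite // nnegrE ltW.
Qed.

Lemma nested_sum_single n m (r : R) (t : 'I_m -> R) (a : m.-tuple 'I_n -> R) js :
  0 <= r -> (forall k, 0 < t k) -> (forall js, 0 <= a js) ->
  a js `^ r <= nested_sum r t a.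
Proof.
elim: m r t a js => [|m IH] r t a js r0 t0 a0 /=; first by rewrite tuple0.
have := IH (t ord0) (fun k => t (lift ord0 k))
  (fun js' => a [tuple of thead js :: js']) [tuple of behead js].
rewrite -[[tuple of thead js :: _]](_ : js = _); last first.
  by apply: val_inj; rewrite {1}(tuple_eta js).
move=> /(_ (ltW (t0 _)) (fun k => t0 _) (fun js => a0 _)) H.
have -> : a js `^ r = (a js `^ t ord0) `^ (r / t ord0).
  by rewrite -powRrM mulrC divfK ?gt_eqF.
apply: powR_le_mono; [by rewrite divr_ge0 // ltW | exact: powR_ge0|].
apply: le_trans H _; rewrite [leRHS](bigD1 (thead js)) //= lerDl.
by apply: sumr_ge0 => j _; exact: nested_sum_ge0.
Qed.

(** One coefficient for every value of the index [k] suffices: the levels before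
    [k] are reduced to their term at [v0], the level [k] has [n] terms, and below
    it a single coefficient gives at least one. *)
Lemma nested_sum_diag n m (k : 'I_m) (r : R) (t : 'I_m -> R)
    (a : m.-tuple 'I_n -> R) (J : 'I_n -> m.-tuple 'I_n) (v0 : 'I_n) :
  0 <= r -> (forall k, 0 < t k) -> (forall js, 0 <= a js) ->
  (forall v, 1 <= a (J v)) -> (forall v, tnth (J v) k = v) ->
  (forall v (l : 'I_m), (l < k)%N -> tnth (J v) l = v0) ->
  n%:R `^ (r / t k) <= nested_sum r t a.
Proof.
elim: m k r t a J => [|m IH] k r t a J r0 t0 a0 aJ Jk Jl /=; first by have := ltn_ord k.
have rt0 : 0 <= r / t ord0 by rewrite divr_ge0 // ltW.
have JE v : [tuple of tnth (J v) ord0 :: behead (J v)] = J v.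
  by apply: val_inj; rewrite [in RHS](tuple_eta (J v)).
case: (unliftP ord0 k) Jk Jl => [k' ->|->] Jk Jl.
  have Jh v : tnth (J v) ord0 = v0 by exact: Jl.
  have JS v l : tnth (J v) (lift ord0 l) = tnth [tuple of behead (J v)] l.
    by rewrite -[in LHS]JE tnthS.
  have H : n%:R `^ (t ord0 / t (lift ord0 k')) <=
      nested_sum (t ord0) (fun k => t (lift ord0 k)) (fun js => a [tuple of v0 :: js]).
    apply: (IH k' _ _ _ (fun v => [tuple of behead (J v)])) => //.
    - by rewrite ltW.
    - by move=> v; rewrite -[X in [tuple of X :: _]](Jh v) JE.
    - by move=> v; rewrite -JS Jk.
    - by move=> v l lk; rewrite -JS Jl.
  have -> : r / t (lift ord0 k') = t ord0 / t (lift ord0 k') * (r / t ord0).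
    by field; rewrite !gt_eqF.
  rewrite powRrM; apply: powR_le_mono rt0 (powR_ge0 _ _) _.
  apply: le_trans H _; rewrite [leRHS](bigD1 v0) //= lerDl.
  by apply: sumr_ge0 => j _; exact: nested_sum_ge0.
apply: powR_le_mono rt0 (ler0n _ _) _.
rewrite -[n in leLHS]card_ord -sum1_card natr_sum; apply: ler_sum => v _.
have := nested_sum_single (t := fun k => t (lift ord0 k))
  (a := fun js => a [tuple of v :: js]) [tuple of behead (J v)]
  (ltW (t0 ord0)) (fun k => t0 _) (fun js => a0 _).
apply: le_trans.
have -> : [tuple of v :: [tuple of behead (J v)]] = J v.
  by rewrite -[in RHS]JE Jk.
by have := powR_le_mono (ltW (t0 ord0)) ler01 (aJ v); rewrite powR1.
Qed.

Variables (F : scalar_field) (m n : nat) (p : 'I_m -> \bar R) (k : 'I_m) (v0 : 'I_n).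
Hypothesis p1 : forall l, (1 <= p l)%E.
Local Notation K := (scalars R F).
Local Notation V := 'rV[scalars R F]_n.

(** In the variables before [k] the form reads the coordinate [v0] only, so that
    they do not contribute to the growth in [n]. *)
Definition diag_index (l : 'I_m) (j : 'I_n) : 'I_n := if (l < k)%N then v0 else j.

Definition diag_form (z : 'I_m -> V) : K := \sum_j \prod_l z l 0 (diag_index l j).

Lemma diag_form_multilinear : multilinear diag_form.
Proof.
move=> z l c v w.
have E x : diag_form (dfwith z l x) =
    \sum_j x 0 (diag_index l j) * \prod_(i | i != l) z i 0 (diag_index i j).
  apply: eq_bigr => j _; rewrite (bigD1 l) //= dfwithin; congr (_ * _).
  by apply: eq_bigr => i il; rewrite dfwithout // eq_sym.
rewrite !E mulr_sumr -big_split /=; apply: eq_bigr => j _.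
by rewrite !mxE mulrDl mulrA.
Qed.

Lemma diag_form_coef v :
  diag_form (fun l => unit_vector R F (diag_index l v)) = 1.
Proof.
rewrite /diag_form (bigD1 v) //= [X in _ + X]big1 ?addr0 => [|j jv].
  by rewrite big1 // => l _; rewrite mxE !eqxx.
by rewrite (bigD1 k) //= mxE /diag_index ltnn (negbTE jv) andbF mul0r.
Qed.

Let theta := \sum_(l < m | (k <= l)%N) recip (p l).
Hypothesis theta_le1 : theta <= 1.

(** Hoelder's inequality for several factors: for every [j], weighted AM-GM with
    weights [1 / p l] is applied to the numbers [n * |z l j| ^ (p l)], [l >= k], and
    to [1] with the remaining weight [1 - theta]; the sum over [j] of the means is
    at most [n]. *)
Lemma diag_form_le : bounded_on_ball p diag_form (n%:R `^ (1 - theta)).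
Proof.
move=> z z1.
have zb l := (lp_norm_le1 (z l) (p1 l)).1 (z1 l).
have n0 : 0 < n%:R :> R by rewrite ltr0n (leq_ltn_trans _ (ltn_ord v0)).
pose w l j := modulus (z l 0 j).
have w0 l j : 0 <= w l j by exact: modulus_ge0.
have w1 l j : w l j <= 1.
  have := zb l; have := p1 l; case: (p l) => [r|_|//] /=; last exact.
  rewrite lee_fin => r1 H; have r0 : 0 < r by exact: lt_le_trans r1.
  have {H} : w l j `^ r <= 1.
    apply: le_trans H; rewrite [leRHS](bigD1 j) //= lerDl.
    by apply: sumr_ge0 => i _; exact: powR_ge0.
  move=> H; have ri : 0 <= r^-1 by rewrite invr_ge0 ltW.
  have := powR_le_mono ri (powR_ge0 _ _) H.
  by rewrite -powRrM divff ?gt_eqF // powRr1 // powR1.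
(* Where [p l] is infinite, the value [0] keeps the sum at most one, and the
   weight [th l] vanishes. *)
pose g l j := if p l is r%:E then w l j `^ r else 0.
have g0 l j : 0 <= g l j by rewrite /g; case: (p l) => // r; exact: powR_ge0.
have g1 l : \sum_j g l j <= 1.
  by have := zb l; have := p1 l; rewrite /g; case: (p l) => [r||] //= _ _;
    rewrite big1.
pose th (l : 'I_m) := if (k <= l)%N then recip (p l) else 0.
have th0 l : 0 <= th l by rewrite /th; case: ifP => // _; exact: recip_ge0.
have th_sum : \sum_l th l = theta by rewrite -big_mkcond.
pose P j := \prod_(l < m | (k <= l)%N) w l j.
have P_le j : P j * n%:R `^ theta <= \sum_l th l * (n%:R * g l j) + (1 - theta).
  have rhs0 : 0 <= \sum_l th l * (n%:R * g l j) + (1 - theta).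
    by rewrite addr_ge0 ?subr_ge0 // sumr_ge0 // => l _; rewrite !mulr_ge0 // ltW.
  have [P0|Pn0] := eqVneq (P j) 0; first by rewrite P0 mul0r.
  have wn0 (l : 'I_m) : (k <= l)%N -> 0 < w l j.
    move=> kl; rewrite lt_neqAle w0 andbT eq_sym.
    by apply: contra_neq Pn0 => wl; rewrite /P (bigD1 l) //= wl mul0r.
  pose y l := if p l is r%:E then ln n%:R + r * ln (w l j) else 0.
  have := expR_weighted_AMGM y th0; rewrite th_sum => /(_ theta_le1) H.
  apply: le_trans (le_trans _ H) _.
    have -> : P j * n%:R `^ theta =
        expR (\sum_(l < m | (k <= l)%N) (recip (p l) * ln n%:R + ln (w l j))).
      rewrite big_split /= -mulr_suml expRD expR_sum mulrC; congr (_ * _).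
        by rewrite /powR gt_eqF.
      by apply: eq_bigr => l kl; rewrite lnK // posrE wn0.
    rewrite ler_expR big_mkcond /=; apply: ler_sum => l _; rewrite /th /y.
    case: ifP => [kl|_]; last by rewrite mul0r.
    have := p1 l; case: (p l) => [r|_|//]; last first.
      by rewrite recipy !mul0r add0r ln_le0.
    rewrite lee_fin => r1; rewrite recipE // mulrDr mulrA mulVf ?mul1r //.
    by rewrite gt_eqF // (lt_le_trans _ r1).
  rewrite lerD2r; apply: ler_sum => l _; rewrite /th.
  case: ifP => [kl|_]; last by rewrite !mul0r.
  rewrite /y /g; have := p1 l; case: (p l) => [r|_|//]; last by rewrite recipy !mul0r.
  rewrite lee_fin => r1; rewrite recipE // ler_wpM2l //.
    by rewrite invr_ge0 (le_trans _ r1).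
  by rewrite expRD lnK ?posrE // /powR gt_eqF ?wn0.
have sumP : (\sum_j P j) * n%:R `^ theta <= n%:R.
  rewrite mulr_suml; apply: le_trans (ler_sum _ (fun j _ => P_le j)) _.
  rewrite big_split /= sumr_const card_ord exchange_big /=.
  apply: (@le_trans _ _ (\sum_l th l * n%:R + (1 - theta) *+ n)).
    rewrite lerD2r; apply: ler_sum => l _; rewrite -mulr_sumr ler_wpM2l //.
    by rewrite -mulr_sumr ler_piMr // ltW.
  by rewrite -mulr_suml th_sum -[(1 - theta) *+ n]mulr_natr -mulrDl addrC subrK mul1r.
apply: (@le_trans _ _ (\sum_j P j)).
  apply: le_trans (modulus_sum _ _) _; apply: ler_sum => j _.
  rewrite modulus_prod /P [leRHS]big_mkcond /=; apply: ler_prod => l _.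
  rewrite modulus_ge0 /= /diag_index [(k <= l)%N]leqNgt; case: ifP => _ /=.
    exact: w1.
  exact: lexx.
rewrite powRB ?(gt_eqF n0) ?implybT // powRr1 ?ler0n //.
by rewrite ler_pdivlMr // powR_gt0.
Qed.

End Optimality.

Lemma hl_exponent_optimal (R : realType) (F : scalar_field) (m : nat)
    (p : 'I_m -> \bar R) (i k : 'I_m) :
  (forall k, (1 <= p k)%E) -> \sum_k recip (p k) < 1 -> (k <= i)%N ->
  optimal_at F p (hl_exponent p i) k.
Proof.
move=> p1 sum1 ki t [t0 [C H]]; rewrite /hl_exponent ki.
set theta := \sum_(l < m | _) _.
have theta1 : theta < 1.
  apply: le_lt_trans sum1; rewrite /theta big_mkcond /=; apply: ler_sum => l _.
  by case: ifP => // _; exact: recip_ge0.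
have : (t k)^-1 <= 1 - theta.
  apply: (powR_growth (C := `|C|)) => // n n0.
  pose v0 := Ordinal n0.
  pose A := @diag_form R F m n k v0.
  have := H n A n0 (@diag_form_multilinear _ _ _ _ _ _).
  have A_le := @diag_form_le R F m n p k v0 p1 (ltW theta1).
  have coef : n%:R `^ (t k)^-1 <= coef_mixed_sum t A.
    rewrite -[(t k)^-1]mul1r.
    apply: (nested_sum_diag
      (J := fun v => [tuple diag_index k v0 l v | l < m]) (v0 := v0)) => //.
    - by move=> js; exact: modulus_ge0.
    - move=> v; rewrite -[leLHS](modulus1 R F) -(@diag_form_coef R F m n k v0 v).
      apply: le_eqW; congr (modulus (A _)).
      by apply: functional_extensionality_dep => l; rewrite tnth_mktuple.
    - by move=> v; rewrite tnth_mktuple /diag_index ltnn.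
    - by move=> v l lk; rewrite tnth_mktuple /diag_index lk.
  have N_le : (form_norm p A <= (n%:R `^ (1 - theta))%:E)%E.
    by apply: ge_ereal_sup => _ [z zb <-]; rewrite lee_fin; exact: A_le.
  have N_ge := form_norm_ge0 A p1.
  move: N_le N_ge; case: (form_norm p A) => [d|//|//]; rewrite !lee_fin => dn d0.
  move=> HC; apply: le_trans coef (le_trans HC _).
  by apply: le_trans (ler_wpM2r d0 (ler_norm C)) (ler_wpM2l _ dn).
move=> tk; rewrite -[leRHS]invrK lef_pV2 ?posrE ?invr_gt0 ?subr_gt0 //.
Qed.

(** * The theorem *)

Theorem corollary1p6 (R : realType) (F : scalar_field) (m : nat)
    (hm : (2 <= m)%N) :
  exists C : R, forall (p : 'I_m -> \bar R) (i : 'I_m),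
    (forall k : 'I_m, (1 <= p k)%E) ->
    2^-1 <= \sum_(k < m) recip (p k) ->
    \sum_(k < m) recip (p k) < 1 ->
    (1 < p i)%E -> (p i <= 2%:E)%E ->
    hardy_littlewood F p (hl_exponent p i) C /\
    (forall k : 'I_m, (k <= i)%N -> optimal_at F p (hl_exponent p i) k).
Proof.
exists (2 ^+ m) => p i p1 _ sum1 _ p2; split; last first.
  by move=> k; exact: hl_exponent_optimal.
move=> n A _ A_lin; have c0 : (0 : R) < 2 ^+ m by rewrite exprn_gt0.
have N0 := form_norm_ge0 A p1.
case E : (form_norm p A) N0 => [d||//] _; last first.
  by rewrite gt0_muley ?lte_fin // leey.
rewrite -EFinM lee_fin; apply: mixed_sum_bound => // z zb.
by rewrite -lee_fin -E; apply: ereal_sup_ubound; exists z.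
Qed.
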